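(* Let $n\ge 1$ and let $X(\mathbb{R}^{n})$ be a rearrangement invariant (r.i.) space on $\mathbb{R}^n$, with representation space $\bar X(0,\infty)$. The following statements are equivalent: 1. There is a non-constant function $f\in X(\mathbb{R}^{n})$ which is a fixed point of the centered Hardy--Littlewood maximal operator, i.e. $\mathcal{M}f=f$. 2. $n\geq 3$ and the function $x\mapsto |x|^{2-n}\chi_{\{x:|x|>1\}}(x)$ belongs to $X(\mathbb{R}^{n})$. 3. $n\geq 3$ and the function $t\mapsto \chi_{[0,1]}(t)+t^{2/n-1}\chi_{[1,\infty)}(t)$ belongs to $\bar{X}(0,\infty)$. 4. $n\geq 3$ and $\big(L^{\frac{n}{n-2},\infty}(\mathbb{R}^{n})\cap L^{\infty}(\mathbb{R}^{n})\big)\subset X(\mathbb{R}^{n})$. 5. $n\geq 3$ and $D_{I_{2}}(X(\mathbb{R}^{n}))\neq\{0\}$.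
   Context: Functions are identified when equal almost everywhere; equalities such as $\mathcal{M}f=f$ are a.e., and ''non-constant'' means not a.e. equal to a constant. The centered Hardy--Littlewood maximal operator is defined on $L^1_{\rm loc}(\mathbb{R}^n)$ by $$\mathcal{M}f(x)=\sup_{r>0}\frac{1}{|B_r|}\int_{B_r}|f(x-y)|\,dy,$$ where $B_r$ is the Euclidean ball of radius $r$ centered at the origin and $|B_r|$ its Lebesgue measure. For a measurable function $f$, $f^*$ denotes its non-increasing rearrangement: the non-increasing right-continuous function on $[0,\infty)$ equimeasurable with $f$. A rearrangement invariant (r.i.) space $X=X(\mathbb{R}^n)$ is a Banach function space on $\mathbb{R}^n$ (in the sense of Bennett--Sharpley, ''Interpolation of Operators'', with Lebesgue measure) with norm $\|\cdot\|_{X(\mathbb{R}^n)}$ such that $\|f\|_{X(\mathbb{R}^n)}=\|g\|_{X(\mathbb{R}^n)}$ whenever $f^*=g^*$. Such a space has a representation as an r.i. function space $\bar X(0,\infty)$ on $(0,\infty)$ such that $\|f\|_{X(\mathbb{R}^n)}=\|f^*\|_{\bar X(0,\infty)}$. For $n\ge 3$, $L^{\frac{n}{n-2},\infty}(\mathbb{R}^n)$ is the weak Lebesgue space of measurable $f$ with $\sup_{t>0}t^{1-2/n}f^*(t)<\infty$. $L^0(\mathbb{R}^n)$ denotes the space of (a.e. finite) measurable functions on $\mathbb{R}^n$. For $n\ge 3$, the Riesz potential is $(I_2f)(x)=\int_{\mathbb{R}^n}|x-y|^{2-n}f(y)\,dy$, and $$D_{I_2}(X(\mathbb{R}^n))=\{f\in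 L^0(\mathbb{R}^n):\ \|I_2|f|\,\|_{X(\mathbb{R}^n)}<\infty\}.$$ *)

(* Defs.v *)
From HB Require Import structures.
From mathcomp Require Import all_boot all_order all_algebra.
From mathcomp Require Import all_classical all_reals all_analysis.
From mathcomp Require Import measurable_realfun ess_sup_inf.
Set Implicit Arguments.
Unset Strict Implicit.
Unset Printing Implicit Defensive.
Import Order.TTheory GRing.Theory Num.Theory.
Import numFieldNormedType.Exports.
Local Open Scope classical_set_scope.
Local Open Scope ring_scope.

(* 'rV[R]_n carries the sigma-algebra generated by the coordinates, that is,
   the Borel sigma-algebra of R^n.  Every Lebesgue measurable function is a.e.
   equal to a Borel one, so the classes of functions modulo a.e. equality are
   the same for both sigma-algebras. *)

Definition measure_rV_display : measure_display -> measure_display.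
Proof. exact. Qed.

Section measurable_rV.
Context (R : realType) (n : nat).

Let coor (i : 'I_n) (x : 'rV[R]_n) : R := x ord0 i.

Let rV_set0 : g_sigma_preimage coor set0.
Proof. exact: sigma_algebra0. Qed.

Let rV_setC A : g_sigma_preimage coor A -> g_sigma_preimage coor (~` A).
Proof. exact: sigma_algebraC. Qed.

Let rV_bigcup (F : _^nat) : (forall i, g_sigma_preimage coor (F i)) ->
  g_sigma_preimage coor (\bigcup_i (F i)).
Proof. exact: sigma_algebra_bigcup. Qed.

HB.instance Definition _ :=
  @isMeasurable.Build (measure_rV_display default_measure_display)
    'rV[R]_n (g_sigma_preimage coor) rV_set0 rV_setC rV_bigcup.

Lemma measurable_coor (i : 'I_n) :
  measurable_fun [set: 'rV[R]_n] (fun x : 'rV[R]_n => x ord0 i).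
Proof.
move=> _ Y mY; rewrite setTI; apply: sub_sigma_algebra => /=.
rewrite -bigcup_seq/=; exists i => /=; first by rewrite mem_index_enum.
by exists Y => //; rewrite setTI.
Qed.

Lemma measurable_fun_rV d (T : measurableType d) (f : T -> 'rV[R]_n) :
  (forall i, measurable_fun [set: T] (fun t => f t ord0 i)) ->
  measurable_fun [set: T] f.
Proof.
move=> mf; apply: measurability => //.
rewrite -bigcup_seq => _ [_ [i _ [B mB <-]] <-].
by rewrite !setTI; have := mf i measurableT B mB; rewrite setTI.
Qed.

End measurable_rV.

Section row_cons.
Context (R : realType) (n : nat).

Definition row_cons (p : measurableTypeR R * 'rV[R]_n) : 'rV[R]_n.+1 :=
  \row_i oapp (fun j => p.2 ord0 j) p.1 (unlift ord0 i).

Definition row_uncons (x : 'rV[R]_n.+1) : measurableTypeR R * 'rV[R]_n :=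
  (x ord0 ord0, \row_i x ord0 (lift ord0 i)).

Lemma row_consK : cancel row_cons row_uncons.
Proof.
move=> [a x]; rewrite /row_uncons !mxE unlift_none/=; congr pair.
by apply/rowP => i; rewrite !mxE liftK.
Qed.

Lemma row_unconsK : cancel row_uncons row_cons.
Proof.
move=> x; apply/rowP => i; rewrite !mxE.
by case: unliftP => [j ->|->]; rewrite /= ?mxE.
Qed.

Lemma measurable_row_cons : measurable_fun setT row_cons.
Proof.
apply: measurable_fun_rV => i; rewrite /row_cons.
under eq_fun do rewrite mxE.
case: unliftP => [j _|_] /=; last exact: measurable_fst.
exact: (measurableT_comp (measurable_coor j) measurable_snd).
Qed.

Lemma measurable_row_uncons : measurable_fun setT row_uncons.
Proof.
apply: measurable_fun_pair; first exact: measurable_coor.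
apply: measurable_fun_rV => i; under eq_fun do rewrite mxE.
exact: measurable_coor.
Qed.

HB.instance Definition _ := isMeasurableFun.Build _ _ _ _ (@row_cons)
  measurable_row_cons.

End row_cons.

Section lebesgue_rV_step.
Local Open Scope ereal_scope.
Context (R : realType) (n : nat).
Variable mu : {sigma_finite_measure set 'rV[R]_n -> \bar R}.

Definition lebesgue_rV_step : set 'rV[R]_n.+1 -> \bar R :=
  pushforward (lebesgue_measure \x mu) (@row_cons R n).

Let step0 : lebesgue_rV_step set0 = 0.
Proof. exact: measure0. Qed.

Let step_ge0 A : 0 <= lebesgue_rV_step A.
Proof. exact: measure_ge0. Qed.

Let step_sigma_additive : semi_sigma_additive lebesgue_rV_step.
Proof. exact: measure_semi_sigma_additive. Qed.

HB.instance Definition _ := isMeasure.Build _ _ _ lebesgue_rV_step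
  step0 step_ge0 step_sigma_additive.

Let step_sigma_finite : sigma_finite setT lebesgue_rV_step.
Proof.
have /sigma_finiteP[F [TF ndF Foo]] := sigma_finiteT (@lebesgue_measure R).
have /sigma_finiteP[G [TG ndG Goo]] := sigma_finiteT mu.
exists (fun k => @row_uncons R n @^-1` (F k `*` G k)).
  rewrite -preimage_bigcup (_ : \bigcup_k _ = setT) ?preimage_setT//.
  rewrite -setXTT TF TG; apply/seteqP; split => -[x y] /=.
    by move=> [k _ [Fx Gy]]; split; exists k.
  move=> [[i _ Fx] [j _ Gy]]; exists (maxn i j) => //; split => /=.
    by move: x Fx; exact/subsetPset/ndF/leq_maxl.
  by move: y Gy; exact/subsetPset/ndG/leq_maxr.
move=> k; have [mF Fk] := Foo k; have [mG Gk] := Goo k; split.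
  rewrite -[X in measurable X]setTI; apply: measurable_row_uncons => //.
  exact: measurableX.
rewrite /lebesgue_rV_step /pushforward -comp_preimage.
rewrite (_ : _ \o _ = id); last by apply/funext => p /=; rewrite row_consK.
by rewrite preimage_id product_measure1E// lte_mul_pinfty// ge0_fin_numE.
Qed.

HB.instance Definition _ := Measure_isSigmaFinite.Build _ _ _ lebesgue_rV_step
  step_sigma_finite.

End lebesgue_rV_step.

Fixpoint lebesgue_rV (R : realType) (n : nat) :
    {sigma_finite_measure set 'rV[R]_n -> \bar R} :=
  if n is m.+1 then lebesgue_rV_step (lebesgue_rV R m) else \d_(0 : 'rV[R]_0).

Lemma lebesgue_rV_box (R : realType) (n : nat) (a b : 'I_n -> R) :
  (forall i, a i <= b i) ->
  lebesgue_rV R n [set x | forall i, a i <= x ord0 i <= b i] =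
  (\prod_(i < n) (b i - a i))%:E.
Proof.
elim: n a b => [|n IHn] a b ab.
  by rewrite big_ord0/= diracE mem_set// => -[].
pose B := [set x : 'rV[R]_n |
  forall i, a (lift ord0 i) <= x ord0 i <= b (lift ord0 i)].
transitivity ((lebesgue_measure \x lebesgue_rV R n)%E
    (`[a ord0, b ord0]%classic `*` B)).
  congr (product_measure1 _ _ _); apply/seteqP; split => -[t x] /=.
    move=> tx; split => [|i].
      by have := tx ord0; rewrite mxE unlift_none/= in_itv.
    by have := tx (lift ord0 i); rewrite mxE liftK.
  rewrite in_itv/= => -[t_ x_] i; rewrite mxE.
  by case: unliftP => [j ->|->].
rewrite product_measure1E//; last first.
  rewrite (_ : B = \bigcap_(i in [set: 'I_n])
    ((fun x : 'rV[R]_n => x ord0 i) @^-1` `[a (lift ord0 i), b (lift ord0 i)])).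
    apply: fin_bigcap_measurable => // i _.
    by rewrite -[X in measurable X]setTI; exact: measurable_coor.
  apply/seteqP; split => x /= xab i; last by have := xab i I; rewrite /= in_itv.
  by move=> _; rewrite /= in_itv; exact: xab.
rewrite big_ord_recl EFinM; congr (_ * _)%E; last exact: IHn.
apply: etrans (lebesgue_measure_itv `[a ord0, b ord0]) _ => /=.
rewrite lte_fin; have := ab ord0; rewrite le_eqVlt => /predU1P[->|->].
  by rewrite ltxx subrr.
by rewrite EFinB.
Qed.

Definition half_line (R : realType) : set (measurableTypeR R) -> \bar R :=
  mrestr (@lebesgue_measure R) (measurable_itv `]0, +oo[).
HB.instance Definition _ (R : realType) := Measure.on (@half_line R).

Section rearrangement.
Local Open Scope ereal_scope.
Context d (T : measurableType d) (R : realType).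
Variable mu : {measure set T -> \bar R}.
Implicit Types f : T -> \bar R.

Definition distribution_fun f (s : R) : \bar R := mu [set x | s%:E < `|f x|].

(* The value at t < 0 is +oo and plays no role. *)
Definition rearrangement f (t : R) : \bar R :=
  ereal_inf [set s%:E |
    s in [set s : R | (0 <= s)%R /\ distribution_fun f s <= t%:E]].

Lemma rearrangement_nonincreasing f (t u : R) :
  (t <= u)%R -> rearrangement f u <= rearrangement f t.
Proof.
move=> tu; apply: ereal_inf_le_tmp => _ [s [s0 st] <-]; exists s => //.
by split => //; rewrite (le_trans st)// lee_fin.
Qed.

Let measurable_gt f (s : R) : measurable_fun setT f ->
  measurable [set x | s%:E < `|f x|].
Proof.
move=> mf; rewrite -[X in measurable X]setTI.
by apply: emeasurable_fun_o_infty => //; exact: measurableT_comp.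
Qed.

Let distribution_fun_nonincreasing f (s u : R) : measurable_fun setT f ->
  (s <= u)%R -> distribution_fun f u <= distribution_fun f s.
Proof.
move=> mf su; apply: le_measure; rewrite ?inE; [exact: measurable_gt..|].
by move=> x /=; apply: le_lt_trans; rewrite lee_fin.
Qed.

Lemma rearrangement_gt f (s t : R) : measurable_fun setT f -> (0 <= s)%R ->
  (s%:E < rearrangement f t) = (t%:E < distribution_fun f s).
Proof.
move=> mf s0; apply/idP/idP => [|ts].
  rewrite !ltNge; apply: contra => st; apply: ereal_inf_lbound.
  by exists s.
pose A k := [set x | (s + k.+1%:R^-1)%:E < `|f x|].
have UA : \bigcup_k A k = [set x | s%:E < `|f x|].
  apply/seteqP; split => x /=.
    by move=> [k _]; apply: le_lt_trans; rewrite lee_fin lerDl.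
  case E : `|f x| => [r||//]; last by exists 0%N => //=; rewrite /A/= E ltry.
  rewrite lte_fin => sr.
  have rs0 : (0 < r - s)%R by rewrite subr_gt0.
  exists (Num.bound (r - s)^-1) => //=.
  rewrite /A/= E lte_fin -ltrBrDl invf_plt ?posrE//.
  apply: lt_trans (archi_boundP _) _; first by rewrite invr_ge0 ltW.
  by rewrite ltr_nat.
have muA : mu (A k) @[k --> \oo] --> distribution_fun f s.
  rewrite /distribution_fun -UA; apply: nondecreasing_cvg_mu.
  - by move=> k; exact: measurable_gt.
  - by rewrite UA; exact: measurable_gt.
  - move=> k l kl; apply/subsetPset => x; apply: le_lt_trans.
    by rewrite lee_fin lerD2l lef_pV2 ?posrE ?ler_nat.
have [k tk] : exists k, t%:E < mu (A k).
  apply: contrapT => /forallNP noA; move: ts; apply/negP; rewrite -leNgt.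
  apply: (cvge_to_le muA).
  by apply: nearW => k; rewrite leNgt; exact/negP/noA.
apply: (@lt_le_trans _ _ (s + k.+1%:R^-1)%:E).
  by rewrite lte_fin ltrDl invr_gt0.
apply: le_ereal_inf_tmp => _ [u [u0 ut] <-]; rewrite lee_fin leNgt.
apply/negP => /ltW uk; move: tk; apply/negP; rewrite -leNgt.
by apply: le_trans ut; exact: distribution_fun_nonincreasing.
Qed.

Lemma rearrangement_equimeasurable f (s : R) :
  measurable_fun setT f -> (0 <= s)%R ->
  @half_line R [set t | s%:E < rearrangement f t] = distribution_fun f s.
Proof.
move=> mf s0.
rewrite (_ : [set t | _] = [set t | t%:E < distribution_fun f s]); last first.
  by apply/seteqP; split => t /=; rewrite rearrangement_gt.
have : 0 <= distribution_fun f s by exact: measure_ge0.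
rewrite /half_line/= /mrestr; case: (distribution_fun f s) => [r r0|?|//].
  rewrite (_ : _ `&` _ = `]0%R, r[%classic); last first.
    by apply/seteqP; split => t /=; rewrite !in_itv/= lte_fin andbT;
      [move=> [-> ->]|move=> /andP[-> ->]].
  apply: etrans (lebesgue_measure_itv `]0%R, r[) _ => /=.
  rewrite lte_fin; move: r0; rewrite lee_fin le_eqVlt => /predU1P[<-|->].
    by rewrite ltxx.
  by rewrite sube0.
rewrite (_ : _ `&` _ = `]0%R, +oo[%classic); last first.
  apply/seteqP; split => t /=; first by move=> [].
  by move=> t0; split => //; rewrite ltry.
by apply: etrans (lebesgue_measure_itv `]0%R, +oo[) _; rewrite /= ltry sube0.
Qed.

Lemma rearrangement_right_continuous f (t : R) : measurable_fun setT f ->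
  rearrangement f u @[u --> t^'+] --> rearrangement f t.
Proof.
move=> mf; rewrite (_ : rearrangement f t =
    ereal_sup (rearrangement f @` [set` Interval (BRight t) +oo%O])).
  apply: nonincreasing_at_right_cvge => // u v _ _.
  exact: rearrangement_nonincreasing.
set S := ereal_sup _; apply/eqP; rewrite eq_le; apply/andP; split; last first.
  apply: ge_ereal_sup => y [u /=]; rewrite in_itv/= andbT => /ltW tu <-.
  exact: rearrangement_nonincreasing.
have rS u : (t < u)%R -> rearrangement f u <= S.
  by move=> tu; apply: ereal_sup_ubound; exists u => //=; rewrite in_itv/= tu.
have S0 : 0 <= S.
  apply: le_trans (rS (t + 1)%R _); last by rewrite ltrDl.
  by apply: le_ereal_inf_tmp => _ [s [s0 _] <-]; rewrite lee_fin.
rewrite leNgt; apply/negP => St.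
have [s Ss] : exists s, S = s%:E.
  by case: S S0 St {rS} => [s| |]//; [move=> _ _; exists s|move=> _; rewrite ltNge leey].
move: S0 St; rewrite Ss lee_fin => s0; rewrite rearrangement_gt// => ts.
have [u tu us] : exists2 u : R, (t < u)%R & u%:E < distribution_fun f s.
  case: (distribution_fun f s) ts => [r| |]//.
    by rewrite lte_fin => tr; exists ((t + r) / 2)%R;
      rewrite ?lte_fin ?midf_lt.
  by move=> _; exists (t + 1)%R; rewrite ?ltrDl ?ltry.
by have := rS _ tu; rewrite Ss leNgt rearrangement_gt// us.
Qed.

End rearrangement.

Section banach_function_space.
Local Open Scope ereal_scope.
Context d (T : measurableType d) (R : realType).
Variable mu : {measure set T -> \bar R}.
Implicit Types (f g : T -> \bar R) (E : set T) (rho : (T -> \bar R) -> \bar R).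

Definition nonneg_mfun f := measurable_fun setT f /\ forall x, 0 <= f x.

(* Axioms (P1)-(P5) of Bennett and Sharpley; rho is only meaningful on
   nonnegative measurable functions, and its values elsewhere are unused. *)
Record banach_function_norm rho : Prop := BanachFunctionNorm {
  bfn_ge0 : forall f, nonneg_mfun f -> 0 <= rho f ;
  bfn_eq0 : forall f, nonneg_mfun f ->
    rho f = 0 <-> \forall x \ae mu, f x = 0 ;
  bfn_scale : forall (a : R) f, (0 <= a)%R -> nonneg_mfun f ->
    rho (fun x => a%:E * f x) = a%:E * rho f ;
  bfn_triangle : forall f g, nonneg_mfun f -> nonneg_mfun g ->
    rho (fun x => f x + g x) <= rho f + rho g ;
  bfn_lattice : forall f g, nonneg_mfun f -> nonneg_mfun g ->
    (\forall x \ae mu, g x <= f x) -> rho g <= rho f ;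
  bfn_fatou : forall (f_ : nat -> T -> \bar R) f,
    (forall k, nonneg_mfun (f_ k)) -> nonneg_mfun f ->
    (\forall x \ae mu, nondecreasing_seq (f_ ^~ x) /\
                       f_ k x @[k --> \oo] --> f x) ->
    nondecreasing_seq (fun k => rho (f_ k)) /\
    rho (f_ k) @[k --> \oo] --> rho f ;
  bfn_indic : forall E, measurable E -> mu E < +oo ->
    rho (fun x => (\1_E x)%:E) < +oo ;
  bfn_local : forall E, measurable E -> mu E < +oo ->
    exists2 C : R, (0 < C)%R &
      forall f, nonneg_mfun f -> \int[mu]_(x in E) f x <= C%:E * rho f }.

Record ri_norm rho : Prop := RiNorm {
  ri_banach : banach_function_norm rho ;
  ri_invariant : forall f g, nonneg_mfun f -> nonneg_mfun g ->
    (forall t, (0 <= t)%R -> rearrangement mu f t = rearrangement mu g t) ->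
    rho f = rho g }.

Definition space_norm rho f : \bar R := rho (fun x => `|f x|).

Definition function_space rho : set (T -> \bar R) :=
  [set f | measurable_fun setT f /\ space_norm rho f < +oo].

Definition L0 : set (T -> \bar R) :=
  [set f | measurable_fun setT f /\ \forall x \ae mu, f x \is a fin_num].

Definition Linfty : set (T -> \bar R) :=
  [set f | measurable_fun setT f /\ 'N[mu]_+oo[f] < +oo].

Definition weakL (p : R) : set (T -> \bar R) :=
  [set f | measurable_fun setT f /\
    ereal_sup [set (t `^ p^-1)%:E * rearrangement mu f t |
               t in `]0%R, +oo[%classic] < +oo].

End banach_function_space.

Definition representation d (T : measurableType d) (R : realType)
    (mu : {measure set T -> \bar R}) (rho : (T -> \bar R) -> \bar R)
    (rho_bar : (measurableTypeR R -> \bar R) -> \bar R) : Prop :=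
  ri_norm (@half_line R) rho_bar /\
  forall f : T -> \bar R, nonneg_mfun f -> rho f = rho_bar (rearrangement mu f).

Section euclidean_space.
Local Open Scope ereal_scope.
Context (R : realType) (n : nat).
Implicit Types (x y : 'rV[R]_n) (f : 'rV[R]_n -> \bar R).

(* The norm `|x| of the library on 'rV[R]_n is the sup norm. *)
Definition enorm x : R := Num.sqrt (\sum_(i < n) x ord0 i ^+ 2).

Definition eball (r : R) : set 'rV[R]_n := [set y | (enorm y < r)%R].

Definition maximal f x : \bar R :=
  ereal_sup [set (lebesgue_rV R n (eball r))^-1 *
                 \int[lebesgue_rV R n]_(y in eball r) `|f (x - y)%R|
            | r in `]0%R, +oo[%classic].

(* 0 `^ a = 0 for a <> 0, so the kernel vanishes instead of being infinite on
   the null set y = x. *)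
Definition riesz_potential2 f x : \bar R :=
  \int[lebesgue_rV R n]_y ((enorm (x - y) `^ (2 - n%:R))%:E * f y).

Definition riesz_domain2 (rho : ('rV[R]_n -> \bar R) -> \bar R) :
    set ('rV[R]_n -> \bar R) :=
  [set f | L0 (lebesgue_rV R n) f /\
           space_norm rho (riesz_potential2 (fun x => `|f x|)) < +oo].

End euclidean_space.

(* Main.v *)
From HB Require Import structures.
Require Import Defs.
From mathcomp Require Import all_boot all_order all_algebra all_fingroup.
From mathcomp Require Import all_classical all_reals all_analysis.
From mathcomp Require Import measurable_realfun ess_sup_inf.
From mathcomp Require Import ring lra.
Set Implicit Arguments.
Unset Strict Implicit.
Unset Printing Implicit Defensive.
Import Order.TTheory GRing.Theory Num.Theory.
Import numFieldNormedType.Exports.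
Local Open Scope classical_set_scope.
Local Open Scope ring_scope.

(** All statements but the first are ways of saying that a function with the
    decay [|x|^(2-n)] of the fundamental solution of the Laplacian belongs to the
    space. The content of the theorem is that nonconstant fixed points exist
    exactly with this decay.

    A fixed point [f] is nonnegative and at least as large as all its averages
    over balls: it is superharmonic in the sense of averages
    ([superaveraging]). Such a function decays no faster than [|x|^(2-n)]. For
    [2a + 2 > n] the power [|x|^(-2a)] is strictly smaller than its averages
    over balls that avoid the origin ([ball_mean_pow_gt]). If [f >= m > 0] on a
    ball around the origin, compare [f] with [H = C(|x|^(-2a) - K)], where
    [H <= m] outside a slightly smaller ball: the positive part [v] of [H - f]
    outside that smaller ball has bounded support and is at most its own
    average [A v] at a small scale, strictly so where [v > 0]. As [v] and [A v]
    have the same integral, [v = 0], that is, [f >= H]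
    ([superaveraging_ge]), all of it almost everywhere. Letting [K] tend to 0 and [2a] to [max(n - 2, 0)] gives
    [f >= c |x|^(2-n)] if [n >= 3]. If [n <= 2] it gives [f >= m] everywhere;
    applied to [f] minus its essential infimum, this forces [f] to be constant
    ([superaveraging_liouville]).

    Conversely, for [n >= 3] the function [(1 + |x|^2)^(-(n-2)/2)] is at least
    its averages ([ball_mean_pow_le]) and is continuous, hence it is a fixed
    point ([maximal_bump]).

    Both inequalities between powers and their averages come from one identity:
    the derivative in [s] of the integral of [g(x - s y)] over the unit ball
    [B] is [s] times the integral over [B] of
    [(1 - |y|^2)/2 * (Laplacian of g)(x - s y)], so the average over a ball is
    monotone in the radius when the Laplacian has a sign. The identity is an
    integration by parts in each coordinate against the weight
    [(1 - |y|^2)/2], which vanishes on the sphere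
    ([integral_by_parts_eball]).

    The remaining implications are comparisons of size. The rearrangement of
    the fixed point above is comparable with [t^(2/n-1)] for large [t]. The
    Riesz potential of the indicator of the unit ball is bounded by a multiple
    of [min(1, |x|^(2-n))], again by the inequality for averages
    ([ball_mean_newton_le]), and every nonzero potential of a nonnegative
    function dominates a multiple of [|x|^(2-n)] at infinity. *)

(** * Lebesgue measure and maps that preserve boxes *)

Section boxes.
Context {R : realType} {n : nat}.
Implicit Types a b : 'I_n -> R.

Definition box a b : set 'rV[R]_n := [set x | forall i, a i <= x ord0 i <= b i].

Definition boxes : set (set 'rV[R]_n) := [set box a b | a in setT & b in setT].

Lemma box_in_boxes a b : boxes (box a b).
Proof. by exists a => //; exists b. Qed.

Lemma boxes_setI : setI_closed boxes.
Proof.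
move=> _ _ [a _ [b _ <-]] [c _ [d _ <-]].
exists (fun i => Order.max (a i) (c i)) => //.
exists (fun i => Order.min (b i) (d i)) => //.
apply/seteqP; split => x /=.
  move=> h; split => i; move: (h i); rewrite ge_max le_min;
    by move=> /andP[/andP[? ?] /andP[? ?]]; apply/andP.
by move=> [h k] i; rewrite ge_max le_min; have /andP[-> ->] := h i;
  have /andP[-> ->] := k i.
Qed.

Lemma coor_bound (x : 'rV[R]_n) :
  exists k : nat, forall i, - k%:R <= x ord0 i <= k%:R.
Proof.
exists (\max_(i < n) Num.bound `|x ord0 i|)%N => i; rewrite -ler_norml.
apply: le_trans (ltW (archi_boundP _)) _; first by [].
by rewrite ler_nat (leq_bigmax i).
Qed.

Lemma box_cover : \bigcup_k box (fun=> - k%:R) (fun=> k%:R) = setT.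
Proof.
by apply/seteqP; split => // x _; have [k kx] := coor_bound x; exists k.
Qed.

Lemma measurable_coor_boxes (i : 'I_n) :
  measurable_fun [set: g_sigma_algebraType boxes]
    ((fun x : 'rV[R]_n => x ord0 i) : g_sigma_algebraType boxes -> R).
Proof.
apply: (measurability _ (RGenCInfty.measurableE R)) => _ [_ [r ->] <-].
rewrite setTI (_ : _ @^-1` _ = \bigcup_k
  box (fun j => if j == i then r else - k%:R) (fun=> k%:R)); last first.
  apply/seteqP; split => x /=.
    rewrite in_itv/= andbT => rx; have [k kx] := coor_bound x.
    by exists k => // j; case: eqP => [->|_ //]; rewrite rx; have /andP[] := kx i.
  by move=> [k _ /(_ i)]; rewrite eqxx in_itv/= andbT => /andP[].
by apply: bigcup_measurable => k _; apply: sub_sigma_algebra; exact: box_in_boxes.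
Qed.

Lemma measurable_box a b : measurable (box a b).
Proof.
rewrite (_ : box a b = \bigcap_(i in [set: 'I_n])
    ((fun x : 'rV[R]_n => x ord0 i) @^-1` `[a i, b i])).
  apply: fin_bigcap_measurable => // i _.
  by rewrite -[X in measurable X]setTI; exact: measurable_coor.
apply/seteqP; split => x /= xab i; last by have := xab i I; rewrite /= in_itv.
by move=> _; rewrite /= in_itv; exact: xab.
Qed.

Lemma measurable_rV_boxes : @measurable _ 'rV[R]_n = <<s boxes >>.
Proof.
apply/seteqP; split => [A mA|].
  have mid : measurable_fun [set: g_sigma_algebraType boxes]
      (id : g_sigma_algebraType boxes -> 'rV[R]_n).
    by apply: measurable_fun_rV => i; exact: measurable_coor_boxes.
  by have := mid measurableT _ mA; rewrite setTI.
apply: smallest_sub; first exact: sigma_algebra_measurable.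
by move=> _ [a _ [b _ <-]]; exact: measurable_box.
Qed.

(** Lebesgue measure is determined by the volumes of boxes, since boxes form a
    generating system that is stable under intersection. All invariances of
    Lebesgue measure below are read off on boxes. *)
Lemma lebesgue_rV_unique (mu : {measure set 'rV[R]_n -> \bar R}) :
  (forall a b, (forall i, a i <= b i) ->
     mu (box a b) = (\prod_(i < n) (b i - a i))%:E) ->
  forall A, measurable A -> lebesgue_rV R n A = mu A.
Proof.
move=> mubox; apply: (measure_unique boxes
  (fun k : nat => box (fun=> - k%:R) (fun=> k%:R))).
- exact: measurable_rV_boxes.
- exact: boxes_setI.
- by move=> k; exact: box_in_boxes.
- exact: box_cover.
- move=> _ [a _ [b _ <-]].
  have [ab|] := pselect (forall i, a i <= b i).
    by rewrite mubox//; exact: lebesgue_rV_box.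
  move=> /existsNP[i /negP nab]; rewrite (_ : box a b = set0) ?measure0//.
  by apply/seteqP; split => // x /(_ i) /andP[/le_trans/[apply]]; exact/negP.
- move=> k; rewrite /= [X in (X < _)%E](lebesgue_rV_box _) ?ltry// => i.
  by rewrite (@le_trans _ _ 0)// ?oppr_le0.
Qed.

End boxes.

Section affine.
Context {R : realType} {n : nat}.
Implicit Types (c : R) (v x : 'rV[R]_n) (s : {perm 'I_n}).
Local Notation lam := (lebesgue_rV R n).

(** Dilations, translations and permutations of the coordinates together: preimages
    of boxes are boxes, so the effect on volumes is explicit. *)
Definition affine c s v x : 'rV[R]_n := \row_i (c * x ord0 (s i) + v ord0 i).

Lemma measurable_affine c s v : measurable_fun setT (affine c s v).
Proof.
apply: measurable_fun_rV => i; under eq_fun do rewrite mxE.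
apply: measurable_funD; last exact: measurable_cst.
by apply: measurable_funM; [exact: measurable_cst|exact: measurable_coor].
Qed.

Definition affine_measure c (c0 : 0 < c) s v : {measure set 'rV[R]_n -> \bar R} :=
  mscale (NngNum (ltW (exprn_gt0 n c0)))
    (measure_function_pushforward__canonical__measure_function_Measure
      lam (measurable_affine c s v)).

Lemma affine_preimage_box c s v a b : 0 < c ->
  affine c s v @^-1` box a b =
  box (fun i => (a ((s^-1)%g i) - v ord0 ((s^-1)%g i)) / c)
      (fun i => (b ((s^-1)%g i) - v ord0 ((s^-1)%g i)) / c).
Proof.
move=> c0; apply/seteqP; split => x /=.
  move=> xab i; move: (xab ((s^-1)%g i)); rewrite mxE permKV => /andP[ax xb].
  by rewrite ler_pdivrMr// ler_pdivlMr// [_ * c]mulrC lerBlDr lerBrDr ax.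
move=> xab i; move: (xab (s i)); rewrite mxE permK.
by rewrite ler_pdivrMr// ler_pdivlMr// [_ * c]mulrC lerBlDr lerBrDr.
Qed.

Lemma lebesgue_rV_affineE c (c0 : 0 < c) s v A : measurable A ->
  lam A = affine_measure c0 s v A.
Proof.
apply: lebesgue_rV_unique => a b ab.
rewrite /affine_measure/= /mscale/= /pushforward affine_preimage_box//.
have -> : (\prod_(i < n) (b i - a i) = c ^+ n * \prod_(i < n)
   ((b ((s^-1)%g i) - v ord0 ((s^-1)%g i)) / c -
    (a ((s^-1)%g i) - v ord0 ((s^-1)%g i)) / c))%R.
  rewrite (reindex_inj (@perm_inj _ (s^-1)%g))/=.
  rewrite -[X in c ^+ X](card_ord n) -prodr_const -big_split/=.
  apply: eq_bigr => i _; rewrite -mulrBl mulrCA mulfV ?gt_eqF// mulr1; ring.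
rewrite EFinM; congr (_ * _)%E; apply: lebesgue_rV_box => i.
by rewrite ler_pM2r ?invr_gt0// lerD2r.
Qed.

Lemma ge0_integral_affine c s v D (f : 'rV[R]_n -> \bar R) : 0 < c ->
  measurable D -> measurable_fun setT f -> (forall x, 0 <= f x)%E ->
  (\int[lam]_(x in D) f x =
   (c ^+ n)%:E * \int[lam]_(x in affine c s v @^-1` D) f (affine c s v x))%E.
Proof.
move=> c0 mD mf f0.
rewrite (@eq_measure_integral _ _ _ D (affine_measure c0 s v)); last first.
  by move=> A mA _; exact: lebesgue_rV_affineE.
rewrite ge0_integral_mscale//=; last exact: measurable_funTS.
congr (_ * _)%E; rewrite (ge0_integral_pushforward (measurable_affine c s v))//.
exact: measurable_funTS.
Qed.

End affine.

(** * The Euclidean norm and the volume of balls *)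

Section euclidean_norm.
Context {R : realType} {n : nat}.
Implicit Types (x y z : 'rV[R]_n) (r : R).

Definition sqn x : R := \sum_(i < n) x ord0 i ^+ 2.

Lemma sqn_ge0 x : 0 <= sqn x.
Proof. by apply: sumr_ge0 => i _; exact: sqr_ge0. Qed.

Lemma enorm_ge0 x : 0 <= enorm x.
Proof. exact: sqrtr_ge0. Qed.

Lemma sqr_enorm x : enorm x ^+ 2 = sqn x.
Proof. by rewrite sqr_sqrtr// sqn_ge0. Qed.

Lemma coor_le_sqn x i : x ord0 i ^+ 2 <= sqn x.
Proof.
by rewrite /sqn (bigD1 i)//= lerDl sumr_ge0// => j _; exact: sqr_ge0.
Qed.

Lemma coor_le_enorm x i : `|x ord0 i| <= enorm x.
Proof.
rewrite -(@ler_pXn2r _ 2)// ?nnegrE ?enorm_ge0// sqr_enorm real_normK ?num_real//.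
exact: coor_le_sqn.
Qed.

Lemma enorm_eq0 x : enorm x = 0 -> x = 0.
Proof.
move=> x0; apply/rowP => i; rewrite mxE; apply/eqP.
by rewrite -normr_eq0 eq_le normr_ge0 -x0 coor_le_enorm.
Qed.

Lemma enorm0 : enorm (0 : 'rV[R]_n) = 0.
Proof.
rewrite /enorm big1 ?sqrtr0// => i _.
by rewrite mxE expr0n.
Qed.

Lemma sqnZ a x : sqn (a *: x) = a ^+ 2 * sqn x.
Proof. by rewrite /sqn mulr_sumr; apply: eq_bigr => i _; rewrite mxE exprMn. Qed.

Lemma enormZ a x : enorm (a *: x) = `|a| * enorm x.
Proof.
by rewrite /enorm -/(sqn _) sqnZ sqrtrM ?sqr_ge0// sqrtr_sqr.
Qed.

Lemma enormN x : enorm (- x) = enorm x.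
Proof. by rewrite -scaleN1r enormZ normrN normr1 mul1r. Qed.

Lemma cauchy_schwarz x y :
  \sum_(i < n) x ord0 i * y ord0 i <= enorm x * enorm y.
Proof.
have [x0|x0] := eqVneq (enorm x) 0.
  by rewrite x0 mul0r (enorm_eq0 x0) big1// => i _; rewrite mxE mul0r.
have [y0|y0] := eqVneq (enorm y) 0.
  by rewrite y0 mulr0 (enorm_eq0 y0) big1// => i _; rewrite mxE mulr0.
have ab0 : 0 < enorm x * enorm y by rewrite mulr_gt0// lt0r enorm_ge0 ?x0 ?y0.
have : 0 <= sqn (enorm y *: x - enorm x *: y) by exact: sqn_ge0.
rewrite (_ : sqn _ = 2 * (enorm x * enorm y) * (enorm x * enorm y -
    \sum_(i < n) x ord0 i * y ord0 i)); last first.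
  transitivity (enorm y ^+ 2 * sqn x + enorm x ^+ 2 * sqn y -
      2 * (enorm x * enorm y) * \sum_(i < n) x ord0 i * y ord0 i).
    rewrite /sqn !mulr_sumr -big_split/= -sumrB; apply: eq_bigr => i _.
    by rewrite !mxE; ring.
  by rewrite -!sqr_enorm; ring.
have p2 : 0 < 2 * (enorm x * enorm y) by rewrite mulr_gt0.
by rewrite pmulr_rge0// subr_ge0.
Qed.

Lemma ler_enormD x y : enorm (x + y) <= enorm x + enorm y.
Proof.
rewrite -(@ler_pXn2r _ 2)// ?nnegrE ?addr_ge0 ?enorm_ge0// sqr_enorm.
have -> : sqn (x + y) = sqn x + sqn y + 2 * \sum_(i < n) x ord0 i * y ord0 i.
  rewrite /sqn mulr_sumr -!big_split/=; apply: eq_bigr => i _.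
  by rewrite mxE; ring.
rewrite -!sqr_enorm sqrrD -mulr_natl.
have := cauchy_schwarz x y; lra.
Qed.

Lemma ler_enormB x y : enorm (x - y) <= enorm x + enorm y.
Proof. by rewrite -(enormN y) ler_enormD. Qed.

Lemma lerB_enorm x y : enorm x - enorm y <= enorm (x - y).
Proof. by rewrite lerBlDr -{1}(subrK y x) ler_enormD. Qed.

Lemma enorm_lt x r : 0 <= r -> (enorm x < r) = (sqn x < r ^+ 2).
Proof.
by move=> r0; rewrite -(@ltr_pXn2r _ 2)// ?nnegrE ?enorm_ge0// sqr_enorm.
Qed.

Lemma enorm_le x r : 0 <= r -> (enorm x <= r) = (sqn x <= r ^+ 2).
Proof.
by move=> r0; rewrite -(@ler_pXn2r _ 2)// ?nnegrE ?enorm_ge0// sqr_enorm.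
Qed.

Lemma measurable_sqn : measurable_fun setT sqn.
Proof.
apply: measurable_sum => i; apply: measurable_funX; exact: measurable_coor.
Qed.

Lemma measurable_enorm : measurable_fun setT (@enorm R n).
Proof.
have := continuous_measurable_fun (@sqrt_continuous R).
by move=> /measurableT_comp; apply; exact: measurable_sqn.
Qed.

Lemma measurable_eball r : measurable (@eball R n r).
Proof.
rewrite -[X in measurable X]setTI.
have := measurable_fun_ltr measurable_enorm (measurable_cst r).
by move=> /(_ measurableT [set true]); apply.
Qed.

Lemma measurable_enorm_gt r : measurable [set x : 'rV[R]_n | r < enorm x].
Proof.
rewrite -[X in measurable X]setTI.
have := measurable_fun_ltr (measurable_cst r) measurable_enorm.
by move=> /(_ measurableT [set true]); apply.
Qed.

End euclidean_norm.

Section ball_volume.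
Context {R : realType} {n : nat}.
Local Notation lam := (lebesgue_rV R n).
Implicit Types (x y : 'rV[R]_n) (r : R).

Lemma affine_dilation r x : affine r 1 0 x = r *: x.
Proof. by apply/rowP => i; rewrite !mxE perm1 addr0. Qed.

Lemma affine_translation v x : affine 1 1 v x = x + v.
Proof. by apply/rowP => i; rewrite !mxE perm1 mul1r. Qed.

Lemma preimage_dilation_eball r s : 0 < r ->
  affine r 1 0 @^-1` @eball R n (r * s) = eball s.
Proof.
move=> r0; apply/seteqP; split => x; rewrite /eball/= affine_dilation enormZ;
  by rewrite gtr0_norm// ltr_pM2l.
Qed.

Lemma ge0_integral_dilation r s (f : 'rV[R]_n -> \bar R) : 0 < r ->
  measurable_fun setT f -> (forall x, 0 <= f x)%E ->
  (\int[lam]_(x in eball (r * s)) f x =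
   (r ^+ n)%:E * \int[lam]_(x in eball s) f (r *: x))%E.
Proof.
move=> r0 mf f0; rewrite (ge0_integral_affine 1 0 r0)//; last exact: measurable_eball.
rewrite preimage_dilation_eball//; congr (_ * _)%E.
by apply: eq_integral => x _; rewrite affine_dilation.
Qed.

Lemma ge0_integral_translation v (f : 'rV[R]_n -> \bar R) :
  measurable_fun setT f -> (forall x, 0 <= f x)%E ->
  (\int[lam]_x f (x + v)%R = \int[lam]_x f x)%E.
Proof.
move=> mf f0; rewrite [RHS](ge0_integral_affine 1 v (@ltr01 R))// expr1n mul1e.
by apply: eq_integral => x _; rewrite affine_translation.
Qed.

Definition ballvol : R := fine (lam (eball 1)).

Lemma eball1_subset_box : @eball R n 1 `<=` box (fun=> - 1) (fun=> 1).
Proof.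
by move=> x x1 i; rewrite -ler_norml (le_trans (coor_le_enorm _ _))// ltW.
Qed.

Lemma lebesgue_eball1_fin : (lam (eball 1) < +oo)%E.
Proof.
apply: (@le_lt_trans _ _ (lam (box (fun=> - 1) (fun=> 1)))).
  apply: le_measure; rewrite ?inE; [exact: measurable_eball|
    exact: measurable_box|exact: eball1_subset_box].
by rewrite [X in (X < _)%E](lebesgue_rV_box _) ?ltry// => i; rewrite lerN10.
Qed.

Lemma ballvolE : lam (eball 1) = ballvol%:E.
Proof. by rewrite /ballvol fineK// ge0_fin_numE// lebesgue_eball1_fin. Qed.

Lemma ballvol_gt0 : 0 < ballvol.
Proof.
rewrite -lte_fin -ballvolE.
pose e : R := n.+1%:R^-1.
have e0 : 0 < e by rewrite invr_gt0.
apply: (@lt_le_trans _ _ (lam (box (fun=> - e) (fun=> e)))).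
  rewrite [X in (_ < X)%E](lebesgue_rV_box _) ?lte_fin ?prodr_gt0//.
    by move=> i _; rewrite opprK addr_gt0.
  by move=> i; rewrite ge0_cp// ltW.
apply: le_measure; rewrite ?inE; [exact: measurable_box|
    exact: measurable_eball|].
move=> x xe; rewrite /eball/= enorm_lt// expr1n.
apply: (@le_lt_trans _ _ (\sum_(i < n) e ^+ 2)).
  apply: ler_sum => i _; rewrite -real_normK ?num_real//.
  by rewrite ler_pXn2r ?nnegrE ?(ltW e0)// ler_norml; exact: xe.
rewrite sumr_const card_ord -mulr_natl expr2 mulrA.
have ne1 : n%:R * e < 1 by rewrite ltr_pdivrMr// mul1r ltr_nat.
apply: le_lt_trans ne1; rewrite ler_piMr// ?mulr_ge0 ?(ltW e0)//.
by rewrite invf_le1// ler1n.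
Qed.

Lemma lebesgue_eball r : 0 < r -> lam (eball r) = (r ^+ n * ballvol)%:E.
Proof.
move=> r0; rewrite EFinM -ballvolE (lebesgue_rV_affineE r0 1 0); last first.
  exact: measurable_eball.
rewrite /affine_measure/= /mscale/= /pushforward.
by rewrite -[in eball r](mulr1 r) preimage_dilation_eball.
Qed.

End ball_volume.

(** * Integration by parts on the unit ball *)

Section bounded_on.
Context {R : realType} {T : Type}.
Implicit Types (A : set T) (f g : T -> R).

Definition bounded_on A f := exists M, forall t, A t -> `|f t| <= M.

Lemma bounded_on_cst A c : bounded_on A (fun=> c).
Proof. by exists `|c|. Qed.

Lemma bounded_onD A f g : bounded_on A f -> bounded_on A g ->
  bounded_on A (fun t => f t + g t).
Proof.
move=> [M fM] [N gN]; exists (M + N) => t At.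
by rewrite (le_trans (ler_normD _ _))// lerD ?fM ?gN.
Qed.

Lemma bounded_onN A f : bounded_on A f -> bounded_on A (fun t => - f t).
Proof. by move=> [M fM]; exists M => t At; rewrite normrN fM. Qed.

Lemma bounded_onB A f g : bounded_on A f -> bounded_on A g ->
  bounded_on A (fun t => f t - g t).
Proof. by move=> bf bg; apply: bounded_onD => //; exact: bounded_onN. Qed.

Lemma bounded_onM A f g : bounded_on A f -> bounded_on A g ->
  bounded_on A (fun t => f t * g t).
Proof.
move=> [M fM] [N gN]; exists (M * N) => t At.
by rewrite normrM ler_pM ?fM ?gN.
Qed.

Lemma bounded_onX A f k : bounded_on A f -> bounded_on A (fun t => f t ^+ k).
Proof.
move=> [M fM]; exists (M ^+ k) => t At.
by rewrite normrX lerXn2r ?nnegrE ?fM// (le_trans _ (fM _ At)).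
Qed.

Lemma bounded_on_sum A (I : Type) (r : seq I) (F : I -> T -> R) :
  (forall i, bounded_on A (F i)) -> bounded_on A (fun t => \sum_(i <- r) F i t).
Proof.
move=> bF; elim: r => [|i r IHr].
  by exists 0 => t _; rewrite big_nil normr0.
have [M iM] := bF i; have [N rN] := IHr.
exists (M + N) => t At; rewrite big_cons.
by rewrite (le_trans (ler_normD _ _))// lerD ?iM ?rN.
Qed.

Lemma powRN_le (c q b : R) : 0 <= b -> 0 < c -> c <= q -> q `^ (- b) <= c `^ (- b).
Proof.
move=> b0 c0 cq; rewrite !powRN lef_pV2 ?posrE ?powR_gt0//; last exact: lt_le_trans cq.
by apply: ge0_ler_powR => //; rewrite nnegrE ltW// (lt_le_trans c0).
Qed.

Lemma bounded_on_powRN A f c b : 0 <= b -> 0 < c -> (forall t, A t -> c <= f t) ->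
  bounded_on A (fun t => f t `^ (- b)).
Proof.
move=> b0 c0 cf; exists (c `^ (- b)) => t At.
by rewrite ger0_norm ?powR_ge0// powRN_le// cf.
Qed.

End bounded_on.

Section parts.
Context {R : realType} {n : nat}.
Local Notation lam := (lebesgue_rV R n.+1).

Lemma bounded_on_integrable m (A : set 'rV[R]_m) f : measurable A ->
  (lebesgue_rV R m A < +oo)%E -> measurable_fun setT f -> bounded_on A f ->
  (lebesgue_rV R m).-integrable A (EFin \o f).
Proof.
move=> mA Afin mf [M fM]; apply: measurable_bounded_integrable => //.
  exact: measurable_funTS.
exists M; split; first exact: num_real.
by move=> N MN x Ax /=; rewrite (le_trans (fM _ Ax))// ltW.
Qed.

Lemma sqn_row_cons (u : R) (z : 'rV[R]_n) :
  sqn (row_cons (u, z)) = u ^+ 2 + sqn z.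
Proof.
rewrite /sqn big_ord_recl /row_cons; congr (_ + _).
  by rewrite mxE unlift_none.
by apply: eq_bigr => i _; rewrite mxE liftK.
Qed.

Lemma row_cons0 (u : R) (z : 'rV[R]_n) : row_cons (u, z) ord0 ord0 = u.
Proof. by rewrite mxE unlift_none. Qed.

Lemma integral_row_cons (f : 'rV[R]_n.+1 -> \bar R) A : measurable A ->
  lam.-integrable A f ->
  (\int[lam]_(x in A) f x =
   \int[lebesgue_rV R n]_z \int[lebesgue_measure]_u (f \_ A) (row_cons (u, z)))%E.
Proof.
move=> mA intf; rewrite integral_mkcond.
have intfA : lam.-integrable setT (f \_ A) by rewrite -integrable_mkcond.
have mfA := measurable_int _ intfA.
have intfAc : (lebesgue_measure \x lebesgue_rV R n)%E.-integrable setT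
    ((f \_ A) \o @row_cons R n).
  apply/integrableP; split.
    exact: (measurableT_comp mfA (@measurable_row_cons R n)).
  have /integrableP[_] := intfA; apply: le_lt_trans.
  rewrite [leRHS](ge0_integral_pushforward (@measurable_row_cons R n))//.
  exact: measurableT_comp.
rewrite (integral21_prod_meas1 intfAc).
rewrite [LHS](integral_pushforward (@measurable_row_cons R n) mfA)//.
Qed.

Variables (H dH : 'rV[R]_n.+1 -> R).
Hypothesis (mH : measurable_fun setT H) (mdH : measurable_fun setT dH).
Hypothesis (bH : bounded_on (eball 1) H) (bdH : bounded_on (eball 1) dH).
Hypothesis HdH : forall u z, u ^+ 2 + sqn z <= 1 ->
  is_derive u 1 (fun t => H (row_cons (t, z))) (dH (row_cons (u, z))).
Hypothesis cdH : forall u z, u ^+ 2 + sqn z <= 1 ->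
  dH (row_cons (t, z)) @[t --> u] --> dH (row_cons (u, z)).

Let D (y : 'rV[R]_n.+1) := y ord0 ord0 * H y - (1 - sqn y) / 2 * dH y.

Let mD : measurable_fun setT D.
Proof.
apply: measurable_funB.
  by apply: measurable_funM => //; exact: measurable_coor.
apply: measurable_funM => //; apply: measurable_funM => //.
by apply: measurable_funB => //; exact: measurable_sqn.
Qed.

(** On a line parallel to the first axis the ball cuts out the segment
    [|u| <= c] with [c^2 = 1 - |z|^2], and the integrand is the derivative of
    [- (c^2 - u^2)/2 * H], which vanishes at both ends. *)
Lemma line_integral_by_parts (z : 'rV[R]_n) :
  (\int[lebesgue_measure]_u ((EFin \o D) \_ (eball 1)) (row_cons (u, z)) = 0)%E.
Proof.
have [z1|z1] := leP 1 (sqn z).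
  rewrite integral0_eq// => u _; rewrite patchE ifF//; apply/negP.
  rewrite inE /eball/= enorm_lt// expr1n sqn_row_cons; apply/negP.
  by rewrite -leNgt (le_trans z1)// lerDr sqr_ge0.
pose c := Num.sqrt (1 - sqn z).
have c0 : 0 < c by rewrite sqrtr_gt0 subr_gt0.
have c2 : c ^+ 2 = 1 - sqn z by rewrite sqr_sqrtr// subr_ge0 ltW.
have uc u : `|u| <= c -> u ^+ 2 + sqn z <= 1.
  move=> uc; rewrite -lerBrDr -c2 -real_normK ?num_real//.
  by rewrite ler_pXn2r ?nnegrE// ltW.
pose G (u : R) : R := - ((c ^+ 2 - u ^+ 2) / 2 * H (row_cons (u, z))).
have dG (u : R) : `|u| <= c -> is_derive u 1 G (D (row_cons (u, z))).
  move=> /uc uz; have dH1 := HdH uz.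
  rewrite /G /D sqn_row_cons row_cons0 c2.
  apply: is_derive_eq.
  by rewrite /GRing.scale/= mulr0; field.
have cDz (u : R) : `|u| <= c -> D (row_cons (t, z)) @[t --> u] --> D (row_cons (u, z)).
  move=> /uc uz; rewrite /D.
  have cH : H (row_cons (t, z)) @[t --> u] --> H (row_cons (u, z)).
    by have dH1 := HdH uz; apply: differentiable_continuous; apply/derivable1_diffP.
  under eq_cvg do rewrite sqn_row_cons row_cons0.
  rewrite sqn_row_cons row_cons0.
  apply: cvgB; first by apply: cvgM => //; exact: cvg_id.
  apply: cvgM; last exact: cdH.
  apply: cvgM; last exact: cvg_cst.
  apply: cvgB; first exact: cvg_cst.
  apply: cvgD; last exact: cvg_cst.
  exact: exprn_continuous.
transitivity (\int[lebesgue_measure]_(u in `[(- c)%R, c]) (D (row_cons (u, z)))%:E)%E.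
  rewrite (@integral_itv_bndoo _ (- c) c _ true false); last first.
    apply/measurable_EFinP/measurable_funTS.
    exact: (measurableT_comp mD (measurableT_comp (@measurable_row_cons R n)
      (measurable_pair2 z))).
  rewrite [RHS]integral_mkcond; apply: eq_integral => u _.
  rewrite !patchE; congr (if _ then _ else _).
  apply/idP/idP; rewrite !inE /eball/= enorm_lt// expr1n sqn_row_cons.
    rewrite -ltrBrDr -c2 -real_normK ?num_real// ltr_pXn2r ?nnegrE ?(ltW c0)//.
    by rewrite in_itv/= -ltr_norml.
  rewrite in_itv/= -ltr_norml => uc1.
  by rewrite -ltrBrDr -c2 -real_normK ?num_real// ltr_pXn2r ?nnegrE ?(ltW c0).
have nc : - c < c by rewrite gtrN.
have dGv u : `|u| <= c -> derivable G u 1.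
  by move=> /dG dG1; exact: ex_derive.
have cG u : `|u| <= c -> G t @[t --> u] --> G u.
  by move=> /dGv dG1; apply: differentiable_continuous; apply/derivable1_diffP.
rewrite (@continuous_FTC2 _ _ G) => //.
- by rewrite /G sqrrN !subrr !mul0r oppr0 subee.
- apply: continuous_in_subspaceT => u; rewrite inE/= in_itv/= -ler_norml => ?.
  exact: cDz.
- split.
  + by move=> u; rewrite in_itv/= -ltr_norml => /ltW; exact: dGv.
  + by apply: cvg_at_right_filter; apply: cG; rewrite normrN gtr0_norm.
  + by apply: cvg_at_left_filter; apply: cG; rewrite gtr0_norm.
- move=> u; rewrite in_itv/= -ltr_norml => /ltW /dG dG1; rewrite derive1E.
  by rewrite derive_val.
Qed.

(** The weight [(1 - |y|^2)/2] has gradient [- y] and vanishes on the sphere. Summed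
    over the coordinates, such identities exchange the radial component of a
    vector field for its divergence without a boundary term. *)
Lemma integral_by_parts_eball :
  (\int[lam]_(y in eball 1)
     (y ord0 ord0 * H y - (1 - sqn y) / 2 * dH y)%:E = 0)%E.
Proof.
rewrite (@integral_row_cons (EFin \o D)); last 2 first.
- exact: measurable_eball.
- apply: bounded_on_integrable => //; first exact: measurable_eball.
    exact: lebesgue_eball1_fin.
  have b1 : bounded_on (@eball R n.+1 1) sqn.
    exists 1 => y; rewrite /eball/= enorm_lt// expr1n => /ltW.
    by rewrite ger0_norm// sqn_ge0.
  apply: bounded_onB; first apply: bounded_onM => //.
    exists 1 => y y1; rewrite (le_trans (coor_le_enorm _ _))// ltW//.
  apply: bounded_onM => //; apply: bounded_onM; last exact: bounded_on_cst.
  by apply: bounded_onB => //; exact: bounded_on_cst.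
by rewrite integral0_eq// => z _; exact: line_integral_by_parts.
Qed.

End parts.

(** * Averages of powers over balls *)

Section power_of_quadratic.
Context {R : realType} {n : nat}.
Local Notation lam := (lebesgue_rV R n.+1).
Implicit Types (x y : 'rV[R]_n.+1) (s u b : R).

Lemma is_derive_powRN (f : R -> R) u df b : 0 < f u -> is_derive u 1 f df ->
  is_derive u 1 (fun t => f t `^ (- b)) (- b * df * f u `^ (- (b + 1))).
Proof.
move=> fu0 fdf.
have -> : - b * df * f u `^ (- (b + 1)) = (- b * f u `^ (- b - 1)) * df.
  by rewrite opprD; ring.
exact: (is_derive1_comp (is_derive1_powR (- b) fu0) fdf).
Qed.

Lemma sqn_line x s u (z : 'rV[R]_n) :
  sqn (x - s *: row_cons (u, z)) = (x ord0 ord0 - s * u) ^+ 2 +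
    sqn (\row_i x ord0 (lift ord0 i) - s *: z).
Proof.
rewrite /sqn big_ord_recl !mxE unlift_none/=; congr (_ + _).
by apply: eq_bigr => i _; rewrite !mxE liftK.
Qed.

Lemma sqn_ray x y s : sqn (x - s *: y) =
  sqn x + s * (- 2 * \sum_(i < n.+1) x ord0 i * y ord0 i) + s ^+ 2 * sqn y.
Proof.
rewrite /sqn !mulr_sumr -!big_split/=; apply: eq_bigr => i _.
by rewrite !mxE; ring.
Qed.

Variables (a beta : R).
Hypothesis a0 : 0 < a.

(** The base of the powers: [beta = 0] gives the subharmonic comparison functions,
    [beta > 0] their smooth superharmonic counterparts. *)
Definition quad x s y := beta + sqn (x - s *: y).

Lemma measurable_quad x s : measurable_fun setT (quad x s).
Proof.
apply: measurable_funD; first exact: measurable_cst.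
apply: (measurableT_comp measurable_sqn).
apply: measurable_fun_rV => i; under eq_fun do rewrite !mxE.
apply: measurable_funB; first exact: measurable_cst.
by apply: measurable_funM; [exact: measurable_cst|exact: measurable_coor].
Qed.

Lemma is_derive_quad_line x s u (z : 'rV[R]_n) b :
  0 < quad x s (row_cons (u, z)) ->
  is_derive u 1 (fun t => quad x s (row_cons (t, z)) `^ (- b))
    (2 * b * s * (x ord0 ord0 - s * u) *
     quad x s (row_cons (u, z)) `^ (- (b + 1))).
Proof.
move=> q0; have dq : is_derive u 1 (fun t => quad x s (row_cons (t, z)))
    (- 2 * s * (x ord0 ord0 - s * u)).
  rewrite /quad; under eq_fun do rewrite sqn_line.
  by apply: is_derive_eq; rewrite /GRing.scale/=; ring.
have := @is_derive_powRN (fun t => quad x s (row_cons (t, z))) u _ b q0 dq.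
by move=> /is_derive_eq; apply; ring.
Qed.

Lemma measurable_quad_powR x s b : measurable_fun setT (fun y => quad x s y `^ b).
Proof. exact: (measurableT_comp (measurable_powR b) (measurable_quad x s)). Qed.

(** Up to a constant, the [i]-th partial derivative of the power [- a] of
    [beta + |.|^2], at the point [x - s y]. *)
Definition grad (i : 'I_n.+1) x s y : R :=
  (x ord0 i - s * y ord0 i) * quad x s y `^ (- (a + 1)).

(** The derivative of [grad i x s y] with respect to the coordinate [y_i]. *)
Definition dgrad (i : 'I_n.+1) x s y : R :=
  2 * s * (a + 1) * (x ord0 i - s * y ord0 i) ^+ 2 * quad x s y `^ (- (a + 2))
  - s * quad x s y `^ (- (a + 1)).

Lemma measurable_sub_coor x s i :
  measurable_fun setT (fun y : 'rV[R]_n.+1 => x ord0 i - s * y ord0 i).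
Proof.
apply: measurable_funB; first exact: measurable_cst.
by apply: measurable_funM; [exact: measurable_cst|exact: measurable_coor].
Qed.

Lemma measurable_grad i x s : measurable_fun setT (grad i x s).
Proof.
by apply: measurable_funM; [exact: measurable_sub_coor|exact: measurable_quad_powR].
Qed.

Lemma measurable_dgrad i x s : measurable_fun setT (dgrad i x s).
Proof.
apply: measurable_funB; apply: measurable_funM; try exact: measurable_quad_powR.
  apply: measurable_funM; first exact: measurable_cst.
  by apply: measurable_funX; exact: measurable_sub_coor.
exact: measurable_cst.
Qed.

Lemma bounded_on_coor i : bounded_on (eball 1) (fun y : 'rV[R]_n.+1 => y ord0 i).
Proof.
by exists 1 => y /ltW; apply: le_trans; exact: coor_le_enorm.
Qed.

Lemma bounded_on_sqn : bounded_on (eball 1) (@sqn R n.+1).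
Proof.
exists 1 => y; rewrite /eball/= enorm_lt// expr1n => /ltW.
by rewrite ger0_norm// sqn_ge0.
Qed.

Section fixed_radius.
Variables (x : 'rV[R]_n.+1) (s c : R).
Hypotheses (c0 : 0 < c) (cq : forall y, sqn y <= 1 -> c <= quad x s y).

Lemma bounded_on_quad_powR b : 0 <= b ->
  bounded_on (eball 1) (fun y => quad x s y `^ (- b)).
Proof.
move=> b0; apply: (bounded_on_powRN b0 c0) => y; rewrite /eball/= enorm_lt//.
by rewrite expr1n => /ltW; exact: cq.
Qed.

Let bounded_sub_coor i :
  bounded_on (eball 1) (fun y : 'rV[R]_n.+1 => x ord0 i - s * y ord0 i).
Proof.
apply: bounded_onB; first exact: bounded_on_cst.
by apply: bounded_onM; [exact: bounded_on_cst|exact: bounded_on_coor].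
Qed.

Let a1 : 0 <= a + 1. Proof. by rewrite addr_ge0// ltW. Qed.
Let a2 : 0 <= a + 2. Proof. by rewrite addr_ge0// ltW. Qed.

Lemma bounded_on_grad i : bounded_on (eball 1) (grad i x s).
Proof. by apply: bounded_onM => //; exact: bounded_on_quad_powR. Qed.

Lemma bounded_on_dgrad i : bounded_on (eball 1) (dgrad i x s).
Proof.
apply: bounded_onB; apply: bounded_onM; try exact: bounded_on_quad_powR.
  apply: bounded_onM; first exact: bounded_on_cst.
  exact: bounded_onX.
exact: bounded_on_cst.
Qed.

Lemma integral_by_parts_grad0 :
  (\int[lam]_(y in eball 1) (y ord0 ord0 * grad ord0 x s y -
     (1 - sqn y) / 2 * dgrad ord0 x s y)%:E = 0)%E.
Proof.
apply: integral_by_parts_eball.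
- exact: measurable_grad.
- exact: measurable_dgrad.
- exact: bounded_on_grad.
- exact: bounded_on_dgrad.
- move=> u z uz.
  have q0 : 0 < quad x s (row_cons (u, z)).
    by apply: (lt_le_trans c0); apply: cq; rewrite sqn_row_cons.
  have dp := @is_derive_quad_line x s u z (a + 1) q0.
  rewrite /grad /dgrad; under eq_fun do rewrite row_cons0.
  rewrite row_cons0.
  apply: is_derive_eq; rewrite /GRing.scale/=.
  by rewrite -addrA (_ : 1 + 1 = 2)//; ring.
- move=> u z uz.
  have q0 : 0 < quad x s (row_cons (u, z)).
    by apply: (lt_le_trans c0); apply: cq; rewrite sqn_row_cons.
  have dp := @is_derive_quad_line x s u z (a + 1) q0.
  have dp2 := @is_derive_quad_line x s u z (a + 2) q0.
  rewrite /dgrad; under eq_cvg do rewrite row_cons0.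
  rewrite row_cons0.
  apply: (@differentiable_continuous _ _ _ u (fun t : R => 2 * s * (a + 1) *
    (x ord0 ord0 - s * t) ^+ 2 * quad x s (row_cons (t, z)) `^ (- (a + 2)) -
    s * quad x s (row_cons (t, z)) `^ (- (a + 1)))); apply/derivable1_diffP.
  exact: ex_derive.
Qed.

Lemma integrable_by_parts_grad i : lam.-integrable (eball 1) (EFin \o
  (fun y => y ord0 i * grad i x s y - (1 - sqn y) / 2 * dgrad i x s y)).
Proof.
apply: bounded_on_integrable.
- exact: measurable_eball.
- exact: lebesgue_eball1_fin.
- apply: measurable_funB; apply: measurable_funM.
  + exact: measurable_coor.
  + exact: measurable_grad.
  + by apply: measurable_funM => //; apply: measurable_funB => //; exact: measurable_sqn.
  + exact: measurable_dgrad.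
- apply: bounded_onB; apply: bounded_onM.
  + exact: bounded_on_coor.
  + exact: bounded_on_grad.
  + apply: bounded_onM; last exact: bounded_on_cst.
    by apply: bounded_onB; [exact: bounded_on_cst|exact: bounded_on_sqn].
  + exact: bounded_on_dgrad.
Qed.

End fixed_radius.

Definition permute (p : {perm 'I_n.+1}) (x : 'rV[R]_n.+1) := affine 1 p 0 x.

Lemma permuteE p x i : permute p x ord0 i = x ord0 (p i).
Proof. by rewrite mxE mul1r mxE addr0. Qed.

Lemma sqn_permute p x : sqn (permute p x) = sqn x.
Proof.
rewrite /sqn [RHS](reindex_inj (@perm_inj _ p))/=.
by apply: eq_bigr => i _; rewrite permuteE.
Qed.

(** Moves the distinguished coordinate of the integration by parts: the ball and
    the quadratic function are symmetric in the coordinates. *)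
Lemma integral_permute p (f : 'rV[R]_n.+1 -> \bar R) : measurable_fun setT f ->
  (\int[lam]_(y in eball 1) f y = \int[lam]_(y in eball 1) f (permute p y))%E.
Proof.
move=> mf; rewrite [LHS]integralE [RHS]integralE.
have pB : affine 1 p 0 @^-1` @eball R n.+1 1 = eball 1.
  by apply/seteqP; split => y; rewrite /eball/= /enorm -!/(sqn _) sqn_permute.
have ge0 (g : 'rV[R]_n.+1 -> \bar R) : measurable_fun setT g ->
    (forall y, 0 <= g y)%E ->
    (\int[lam]_(y in eball 1) g y = \int[lam]_(y in eball 1) g (permute p y))%E.
  move=> mg g0; rewrite [LHS](ge0_integral_affine p 0 (@ltr01 R))//.
    by rewrite expr1n mul1e pB.
  exact: measurable_eball.
rewrite (_ : (fun y => f (permute p y)) = f \o permute p)//.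
rewrite [in RHS]funepos_comp [in RHS]funeneg_comp.
congr (_ - _)%E; rewrite ge0//.
  exact: measurable_funepos.
exact: measurable_funeneg.
Qed.

Lemma quad_permute i x s y : quad x s (permute (tperm ord0 i) y) =
  quad (permute (tperm ord0 i) x) s y.
Proof.
rewrite /quad -(sqn_permute (tperm ord0 i) (x - _)); congr (_ + sqn _).
by apply/rowP => j; rewrite !(mxE, mul1r, addr0) tpermK.
Qed.

Lemma integral_by_parts_grad x s c i : 0 < c ->
  (forall y, sqn y <= 1 -> c <= quad x s y) ->
  (\int[lam]_(y in eball 1) (y ord0 i * grad i x s y -
     (1 - sqn y) / 2 * dgrad i x s y)%:E = 0)%E.
Proof.
move=> c0 cq; pose p := tperm ord0 i.
rewrite (integral_permute p); last first.
  apply/measurable_EFinP; apply: measurable_funB; apply: measurable_funM.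
  + exact: measurable_coor.
  + exact: measurable_grad.
  + by apply: measurable_funM => //; apply: measurable_funB => //; exact: measurable_sqn.
  + exact: measurable_dgrad.
rewrite -[RHS](@integral_by_parts_grad0 (permute p x) s c c0); last first.
  by move=> y y1; rewrite -quad_permute; apply: cq; rewrite sqn_permute.
apply: eq_integral => y _.
by rewrite /grad /dgrad sqn_permute !permuteE tpermR tpermL quad_permute.
Qed.

(** Up to the factor [2a], the Laplacian of the power [- a] of [beta + |.|^2] at
    [x - s y]. *)
Definition lap x s y : R :=
  (2 * (a + 1) * sqn (x - s *: y) - n.+1%:R * quad x s y) *
  quad x s y `^ (- (a + 2)).

Lemma sum_dgrad x s y : 0 < quad x s y ->
  \sum_(i < n.+1) dgrad i x s y = s * lap x s y.
Proof.
move=> q0; rewrite sumrB -mulr_suml -mulr_sumr sumr_const card_ord /lap.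
have -> : \sum_(i < n.+1) (x ord0 i - s * y ord0 i) ^+ 2 = sqn (x - s *: y).
  by apply: eq_bigr => i _; rewrite !mxE.
have -> : quad x s y `^ (- (a + 1)) = quad x s y * quad x s y `^ (- (a + 2)).
  rewrite -{2}(powRr1 (ltW q0)) -powRD ?(gt_eqF q0) ?implybT//.
  by congr (_ `^ _); ring.
by rewrite -mulr_natl; ring.
Qed.

Definition unit_ball_pow x s : R := \int[lam]_(y in eball 1) quad x s y `^ (- a).

Lemma integrable_lap x s c : 0 < c -> (forall y, sqn y <= 1 -> c <= quad x s y) ->
  lam.-integrable (eball 1) (EFin \o (fun y => (1 - sqn y) / 2 * lap x s y)).
Proof.
move=> c0 cq; have mB := @measurable_eball R n.+1 1.
have m1 : measurable_fun setT (fun y : 'rV[R]_n.+1 => (1 - sqn y) / 2).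
  by apply: measurable_funM => //; apply: measurable_funB => //; exact: measurable_sqn.
have b1 : bounded_on (eball 1) (fun y : 'rV[R]_n.+1 => (1 - sqn y) / 2).
  apply: bounded_onM; last exact: bounded_on_cst.
  by apply: bounded_onB; [exact: bounded_on_cst|exact: bounded_on_sqn].
have a2 : 0 <= a + 2 by rewrite addr_ge0// ltW.
have mx : measurable_fun setT (fun y => sqn (x - s *: y)).
  rewrite (_ : (fun _ => _) = fun y => quad x s y - beta); last first.
    by apply/funext => y; rewrite /quad addrAC subrr add0r.
  by apply: measurable_funB => //; exact: measurable_quad.
have bx : bounded_on (eball 1) (fun y => sqn (x - s *: y)).
  exists ((enorm x + `|s|) ^+ 2) => y y1; rewrite ger0_norm ?sqn_ge0// -sqr_enorm.
  rewrite ler_pXn2r ?nnegrE ?enorm_ge0 ?addr_ge0 ?enorm_ge0//.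
  rewrite (le_trans (ler_enormB _ _))// lerD2l enormZ ler_piMr//.
  exact: ltW.
apply: bounded_on_integrable => //.
- exact: lebesgue_eball1_fin.
- apply: measurable_funM => //; apply: measurable_funM; last first.
    exact: measurable_quad_powR.
  apply: measurable_funB; first exact: measurable_funM.
  by apply: measurable_funM => //; exact: measurable_quad.
- apply: bounded_onM => //; apply: bounded_onM; last first.
    exact: bounded_on_quad_powR c0 cq _ a2.
  apply: bounded_onB; apply: bounded_onM => //; try exact: bounded_on_cst.
  by apply: bounded_onD => //; exact: bounded_on_cst.
Qed.

(** The left-hand side is the derivative in [s] of [unit_ball_pow x s]; summing
    the integrations by parts over the coordinates produces the Laplacian, whose
    sign therefore governs the monotonicity of averages in the radius. *)
Lemma integral_radial_derivative x s c : 0 < c ->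
  (forall y, sqn y <= 1 -> c <= quad x s y) ->
  \int[lam]_(y in eball 1) (2 * a * \sum_(i < n.+1) y ord0 i * grad i x s y) =
  2 * a * s * \int[lam]_(y in eball 1) ((1 - sqn y) / 2 * lap x s y).
Proof.
move=> c0 cq; have mB := @measurable_eball R n.+1 1.
have int_lap := integrable_lap c0 cq.
pose D i y := y ord0 i * grad i x s y - (1 - sqn y) / 2 * dgrad i x s y.
have intD i : lam.-integrable (eball 1) (EFin \o D i).
  exact: integrable_by_parts_grad c0 cq i.
have int_sum : lam.-integrable (eball 1) (EFin \o (fun y => \sum_(i < n.+1) D i y)).
  rewrite (_ : _ \o _ = (fun y => \sum_(i < n.+1) (EFin \o D i) y)%E); last first.
    by apply/funext => y /=; rewrite sumEFin.
  exact: integrable_sum.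
have int_sum0 : \int[lam]_(y in eball 1) (\sum_(i < n.+1) D i y) = 0.
  rewrite /Rintegral; under eq_integral do rewrite -sumEFin.
  rewrite (@integral_sum _ _ _ _ _ _ _ (fun i y => (D i y)%:E))// big1// => i _.
  exact: integral_by_parts_grad c0 cq.
transitivity (\int[lam]_(y in eball 1) (2 * a * (\sum_(i < n.+1) D i y) +
    2 * a * s * ((1 - sqn y) / 2 * lap x s y))).
  apply: eq_Rintegral => y; rewrite inE => y1.
  have q0 : 0 < quad x s y.
    apply: lt_le_trans c0 (cq _ _); move: y1; rewrite /eball/= enorm_lt// expr1n.
    exact: ltW.
  rewrite /D sumrB -mulr_sumr sum_dgrad//; ring.
rewrite RintegralD//; last 2 first.
- exact: (integrableZl mB (2 * a) int_sum).
- exact: (integrableZl mB (2 * a * s) int_lap).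
by rewrite !RintegralZl// int_sum0 mulr0 add0r.
Qed.

Lemma is_derive_quad_ray x y s : 0 < quad x s y ->
  is_derive s 1 (fun t => quad x t y `^ (- a))
    (2 * a * \sum_(i < n.+1) y ord0 i * grad i x s y).
Proof.
move=> q0; have dq : is_derive s 1 (fun t => quad x t y)
    (- 2 * \sum_(i < n.+1) y ord0 i * (x ord0 i - s * y ord0 i)).
  rewrite /quad; under eq_fun do rewrite sqn_ray.
  apply: is_derive_eq; rewrite /GRing.scale/=.
  rewrite (_ : \sum_(i < n.+1) y ord0 i * (x ord0 i - s * y ord0 i) =
    (\sum_(i < n.+1) x ord0 i * y ord0 i) - s * sqn y); last first.
    by rewrite /sqn mulr_sumr -sumrB; apply: eq_bigr => i _; ring.
  ring.
have := @is_derive_powRN (fun t => quad x t y) s _ a q0 dq.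
move=> /is_derive_eq; apply; rewrite /grad.
under [X in _ = _ * X]eq_bigr do rewrite mulrA.
by rewrite -mulr_suml; ring.
Qed.

(** The base is bounded below uniformly for [|t| < T], which allows
    differentiation under the integral sign. *)
Lemma unit_ball_pow_MVT x (T c s : R) : 0 < c ->
  (forall (t : R) y, `|t| < T -> sqn y <= 1 -> c <= quad x t y) -> 0 < s < T ->
  exists2 t, 0 < t < s & unit_ball_pow x s - unit_ball_pow x 0 =
    2 * a * t * \int[lam]_(y in eball 1) ((1 - sqn y) / 2 * lap x t y) * s.
Proof.
move=> c0 cq /andP[s0 sT].
have cqI (t : R) y : `]-T, T[%classic t -> eball 1 y -> c <= quad x t y.
  rewrite /= in_itv/= -ltr_norml /eball/= enorm_lt// expr1n => tT /ltW.
  exact: cq.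
have dmean (t : R) : `|t| < T -> is_derive t 1 (unit_ball_pow x)
    (2 * a * t * \int[lam]_(y in eball 1) ((1 - sqn y) / 2 * lap x t y)).
  move=> tT; rewrite -(@integral_radial_derivative x t c c0); last first.
    by move=> y; exact: cq.
  have bG : exists2 M : R, 0 <= M & forall (u : R) y, `]-T, T[%classic u -> eball 1 y ->
      `|partial1of2 (fun (t : R) y => quad x t y `^ (- a)) u y| <= M.
    have bp i : bounded_on (`]-T, T[%classic `*` eball 1)
        (fun p : R * 'rV[R]_n.+1 => p.2 ord0 i).
      by exists 1 => p [_ /ltW]; apply: le_trans; exact: coor_le_enorm.
    have bT : bounded_on (`]-T, T[%classic `*` @eball R n.+1 1)
        (fun p : R * 'rV[R]_n.+1 => p.1).
      by exists T => p [/=]; rewrite in_itv/= -ltr_norml => /ltW.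
    have [M dM] : bounded_on (`]-T, T[%classic `*` eball 1)
        (fun p : R * 'rV[R]_n.+1 => 2 * a * \sum_(i < n.+1) p.2 ord0 i *
         ((x ord0 i - p.1 * p.2 ord0 i) * quad x p.1 p.2 `^ (- (a + 1)))).
      apply: bounded_onM; first exact: bounded_on_cst.
      apply: bounded_on_sum => i; apply: bounded_onM => //; apply: bounded_onM.
        by apply: bounded_onB; [exact: bounded_on_cst|exact: bounded_onM].
      apply: (@bounded_on_powRN _ _ _ _ c) => //; first by rewrite addr_ge0// ltW.
      by move=> p [p1 p2]; exact: cqI.
    exists (Num.max M 0); first by rewrite le_max lexx orbT.
    move=> u y Iu By; rewrite partial1of2E.
    have dq := @is_derive_quad_ray x y u (lt_le_trans c0 (cqI _ _ Iu By)).
    by rewrite derive_val le_max (dM (u, y)).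
  have [M M0 dM] := bG.
  have It : `]- T, T[%classic t by rewrite /= in_itv/= -ltr_norml.
  have mB := @measurable_eball R n.+1 1.
  have intf (u : R) : `]-T, T[%classic u ->
      lam.-integrable (eball 1) (EFin \o (fun y => quad x u y `^ (- a))).
    move=> Iu; apply: bounded_on_integrable => //.
    - exact: lebesgue_eball1_fin.
    - exact: measurable_quad_powR.
    - by apply: (bounded_on_powRN (ltW a0) c0) => y; exact: cqI.
  have derf (u : R) y : `]-T, T[%classic u -> eball 1 y ->
      derivable (fun t => quad x t y `^ (- a)) u 1.
    move=> Iu By; have := @is_derive_quad_ray x y u (lt_le_trans c0 (cqI _ _ Iu By)).
    by move=> ?; exact: ex_derive.
  have intM : lam.-integrable (eball 1) (EFin \o (fun=> M)).
    apply: bounded_on_integrable => //; first exact: lebesgue_eball1_fin.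
    exact: bounded_on_cst.
  apply: DeriveDef.
    exact: (derivable_under_integral mB It intf derf (fun=> M0) intM dM).
  rewrite -derive1E.
  rewrite (differentiation_under_integral mB It intf derf (fun=> M0) intM dM).
  apply: eq_Rintegral => y; rewrite inE => By; rewrite partial1of2E.
  have ? := @is_derive_quad_ray x y t (lt_le_trans c0 (cqI _ _ It By)).
  exact: derive_val.
have I0s (t : R) : t \in `[0, s] -> `|t| < T.
  by rewrite in_itv/= => /andP[t0 ts]; rewrite ger0_norm// (le_lt_trans ts).
have [| |t t0s ->] := @MVT _ (unit_ball_pow x) (fun t => 2 * a * t *
  \int[lam]_(y in eball 1) ((1 - sqn y) / 2 * lap x t y)) 0 s s0.
- by move=> t t0s; apply: dmean; apply: I0s; exact: subset_itv_oo_cc.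
- apply: derivable_within_continuous => t /I0s /dmean ?; exact: ex_derive.
- by exists t => //; rewrite subr0.
Qed.

End power_of_quadratic.

Section positive_integral.
Context d (T : measurableType d) (R : realType).
Variable mu : {measure set T -> \bar R}.

Lemma integral_gt0 (D : set T) (f : T -> \bar R) : measurable D ->
  (0 < mu D)%E -> measurable_fun D f -> (forall x, D x -> 0 < f x)%E ->
  (0 < \int[mu]_(x in D) f x)%E.
Proof.
move=> mD D0 mf f0; rewrite lt0e integral_ge0 ?andbT; last first.
  by move=> x /f0/ltW.
apply/negP => /eqP f_eq0; suff : mu D = 0 by move=> D_0; rewrite D_0 ltxx in D0.
have : (\int[mu]_(x in D) `|f x| = 0)%E.
  rewrite -f_eq0; apply: eq_integral => x; rewrite inE => /f0/ltW.
  exact: gee0_abs.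
move=> /(ae_eq_integral_abs _ mD mf) [N [mN N0 DN]].
apply/eqP; rewrite -measure_le0 -N0; apply: le_measure; rewrite ?inE//.
by move=> x Dx; apply: DN => /= /(_ Dx) fx0; have := f0 _ Dx; rewrite fx0 ltxx.
Qed.

End positive_integral.

Section ball_means.
Context {R : realType} {n : nat}.
Local Notation lam := (lebesgue_rV R n.+1).
Implicit Types (x y : 'rV[R]_n.+1) (r a beta : R).

Lemma integral_ball_quad x a beta r c : 0 < a -> 0 < r -> 0 < c ->
  (forall y, sqn y <= 1 -> c <= quad beta x r y) ->
  (\int[lam]_(y in eball r) ((beta + sqn (x - y)) `^ (- a))%:E =
   (r ^+ n.+1 * unit_ball_pow a beta x r)%:E)%E.
Proof.
move=> a0 r0 c0 cq; rewrite -{1}(mulr1 r) ge0_integral_dilation//; last 2 first.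
- apply/measurable_EFinP.
  rewrite (_ : (fun _ => _) = fun y => quad beta x 1 y `^ (- a)).
    exact: measurable_quad_powR.
  by apply/funext => y; rewrite /quad scale1r.
- by move=> y; rewrite lee_fin powR_ge0.
rewrite EFinM; congr (_ * _)%E; rewrite /unit_ball_pow /Rintegral fineK//.
apply: integrable_fin_num; first exact: measurable_eball.
apply: bounded_on_integrable.
- exact: measurable_eball.
- exact: lebesgue_eball1_fin.
- exact: measurable_quad_powR.
- exact: (bounded_on_quad_powR c0 cq (ltW a0)).
Qed.

Lemma unit_ball_pow0 x a beta : unit_ball_pow a beta x 0 =
  @ballvol R n.+1 * (beta + sqn x) `^ (- a).
Proof.
transitivity (\int[lam]_(y in eball 1) cst ((beta + sqn x) `^ (- a)) y).
  by apply: eq_Rintegral => y _; rewrite /quad scale0r subr0.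
rewrite (Rintegral_cst lam (@measurable_eball R n.+1 1)) mulrC.
reflexivity.
Qed.

(** When [2a + 2 = n] the Laplacian is a negative multiple of [beta], so the power
    is superharmonic on the whole space. *)
Lemma ball_mean_pow_le x a beta r : 0 < a -> 2 * a + 2 = n.+1%:R -> 0 < beta ->
  0 < r ->
  (\int[lam]_(y in eball r) ((beta + sqn (x - y)) `^ (- a))%:E <=
   lam (eball r) * ((beta + sqn x) `^ (- a))%:E)%E.
Proof.
move=> a0 an b0 r0.
have cq (t : R) y : `|t| < r + 1 -> sqn y <= 1 -> beta <= quad beta x t y.
  by move=> _ _; rewrite lerDl sqn_ge0.
have r1 : 0 < r < r + 1 by rewrite r0 ltrDl ltr01.
rewrite (@integral_ball_quad _ _ _ _ beta)//; last first.
  by move=> y; apply: cq; rewrite gtr0_norm// ltrDl.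
have [t /andP[t0 _] E] := unit_ball_pow_MVT a0 b0 cq r1.
rewrite lebesgue_eball// -EFinM lee_fin -mulrA ler_pM2l ?exprn_gt0//.
rewrite -unit_ball_pow0 -subr_le0 E.
rewrite pmulr_lle0// pmulr_rle0 ?mulr_gt0//.
have lap_le0 y : eball 1 y -> (1 - sqn y) / 2 * lap a beta x t y <= 0.
  rewrite /eball/= enorm_lt// expr1n => y1.
  rewrite pmulr_rle0 ?divr_gt0 ?subr_gt0// /lap pmulr_lle0; last first.
    by rewrite powR_gt0// (lt_le_trans b0)// lerDl sqn_ge0.
  rewrite (_ : 2 * (a + 1) = n.+1%:R); last by rewrite -an; ring.
  by rewrite -mulrBr pmulr_rle0// subr_le0 lerDr ltW.
rewrite /Rintegral (_ : integral _ _ _ = - \int[lam]_(y in eball 1)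
    (- ((1 - sqn y) / 2 * lap a beta x t y))%:E)%E.
  rewrite fineN oppr_le0; apply: fine_ge0; apply: integral_ge0 => y /lap_le0.
  by rewrite lee_fin oppr_ge0.
rewrite -integral_ge0N; last by move=> y /lap_le0; rewrite lee_fin oppr_ge0.
by apply: eq_integral => y _; rewrite EFinN oppeK.
Qed.

(** When [2a + 2 > n] the Laplacian of [|x|^(-2a)] is positive away from the
    origin, and the hypothesis [r < |x|] keeps the origin out of the ball. *)
Lemma ball_mean_pow_gt x a r : 0 < a -> n.+1%:R < 2 * a + 2 ->
  0 < r < enorm x ->
  (lam (eball r) * (sqn x `^ (- a))%:E <
   \int[lam]_(y in eball r) (sqn (x - y) `^ (- a))%:E)%E.
Proof.
move=> a0 an /andP[r0 rx].
(* A radius strictly between [r] and [|x|]: on the balls of radius at most [T] the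
   base stays above [c]. *)
pose T := (r + enorm x) / 2.
have rT : r < T by rewrite midf_lt.
have Tx : T < enorm x by rewrite midf_lt.
pose c := (enorm x - T) ^+ 2.
have c0 : 0 < c by rewrite exprn_gt0// subr_gt0.
have cq (t : R) y : `|t| < T -> sqn y <= 1 -> c <= quad 0 x t y.
  move=> tT y1; rewrite /quad add0r -sqr_enorm.
  rewrite ler_pXn2r ?nnegrE ?enorm_ge0 ?subr_ge0 ?(ltW Tx)//.
  rewrite (le_trans _ (lerB_enorm _ _))// lerD2l lerN2 enormZ.
  rewrite (le_trans _ (ltW tT))// ler_piMr// enorm_le// expr1n//.
have r1 : 0 < r < T by rewrite r0.
rewrite [ltRHS](_ : _ = (r ^+ n.+1 * unit_ball_pow a 0 x r)%:E); last first.
  rewrite -(@integral_ball_quad _ _ _ _ c)//.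
    by apply: eq_integral => y _; rewrite add0r.
  by move=> y; apply: cq; rewrite gtr0_norm.
have [t /andP[t0 tr] E] := unit_ball_pow_MVT a0 c0 cq r1.
rewrite lebesgue_eball// -EFinM lte_fin -mulrA ltr_pM2l ?exprn_gt0//.
rewrite -[X in X `^ _]add0r -unit_ball_pow0 -subr_gt0 E.
rewrite pmulr_lgt0// pmulr_rgt0 ?mulr_gt0//.
have cqt : forall y, sqn y <= 1 -> c <= quad 0 x t y.
  by move=> y; apply: cq; rewrite gtr0_norm// (lt_trans tr).
have int_lap := integrable_lap a0 c0 cqt.
rewrite /Rintegral fine_gt0//; apply/andP; split; last first.
  have := integrable_fin_num (@measurable_eball R n.+1 1) int_lap.
  by rewrite fin_numElt => /andP[].
apply: integral_gt0.
- exact: measurable_eball.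
- rewrite [X in (_ < X)%E](@lebesgue_eball R n.+1 1)//.
  by rewrite expr1n mul1r lte_fin ballvol_gt0.
- exact: measurable_int int_lap.
- move=> y; rewrite /eball/= enorm_lt// expr1n => y1.
  have q0 : 0 < quad 0 x t y by apply: (lt_le_trans c0); apply: cqt; exact: ltW.
  rewrite lte_fin mulr_gt0 ?divr_gt0 ?subr_gt0// /lap pmulr_lgt0 ?powR_gt0//.
  rewrite /quad add0r -mulrBl pmulr_lgt0; last by move: q0; rewrite /quad add0r.
  by rewrite subr_gt0 mulrDr mulr1.
Qed.

End ball_means.

(** * Integrals over translated balls *)

Section reflection.
Context {R : realType} {n : nat}.
Local Notation lam := (lebesgue_rV R n).
Implicit Types (x y : 'rV[R]_n) (r : R) (f g : 'rV[R]_n -> \bar R).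

Lemma measurable_subr_prod :
  measurable_fun setT (fun p : 'rV[R]_n * 'rV[R]_n => p.1 - p.2).
Proof.
apply: measurable_fun_rV => i; under eq_fun do rewrite !mxE.
apply: measurable_funB.
  exact: (measurableT_comp (measurable_coor i) measurable_fst).
exact: (measurableT_comp (measurable_coor i) measurable_snd).
Qed.

Lemma measurable_reflection x : measurable_fun setT (fun y : 'rV[R]_n => x - y).
Proof. exact: (measurableT_comp measurable_subr_prod (measurable_pair1 x)). Qed.

Lemma lebesgue_rV_reflection x A : measurable A ->
  lam A = lam ((fun y => x - y) @^-1` A).
Proof.
move=> mA; apply: (lebesgue_rV_unique (mu :=
  (measure_function_pushforward__canonical__measure_function_Measure
      lam (measurable_reflection x)))) => // a b ab.
rewrite /= /pushforward (_ : _ @^-1` _ =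
    box (fun i => x ord0 i - b i) (fun i => x ord0 i - a i)); last first.
  apply/seteqP; split => y /= h i; have := h i; rewrite !mxE => /andP[];
    by move=> ? ?; apply/andP; split; lra.
rewrite [LHS](lebesgue_rV_box _); last by move=> i; rewrite lerD2l lerN2.
by congr (_%:E); apply: eq_bigr => i _; ring.
Qed.

Lemma ge0_integral_reflection x f : measurable_fun setT f ->
  (forall y, 0 <= f y)%E -> (\int[lam]_y f (x - y)%R = \int[lam]_y f y)%E.
Proof.
move=> mf f0; rewrite [RHS](@eq_measure_integral _ _ _ setT
  (measure_function_pushforward__canonical__measure_function_Measure
      lam (measurable_reflection x))); last first.
  by move=> A mA _; exact: lebesgue_rV_reflection.
by rewrite (ge0_integral_pushforward (measurable_reflection x)).
Qed.

Definition ballint f r x : \bar R := (\int[lam]_(y in eball r) f (x - y)%R)%E.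

Lemma measurable_indic_eball r :
  measurable_fun setT (fun y : 'rV[R]_n => (\1_(eball r) y)%:E : \bar R).
Proof.
by apply/measurable_EFinP; apply: measurable_indic; exact: measurable_eball.
Qed.

Lemma ballint_indic f r x :
  ballint f r x = (\int[lam]_y (f (x - y)%R * (\1_(eball r) y)%:E))%E.
Proof.
rewrite /ballint integral_mkcond; apply: eq_integral => y _.
by rewrite patchE indicE; case: ifPn => _; rewrite ?mule1 ?mule0.
Qed.

(** The integral over the ball around [x] in the fixed variable: this form is
    monotone in the ball and insensitive to null sets. *)
Lemma ballintE f r x : measurable_fun setT f -> (forall y, 0 <= f y)%E ->
  ballint f r x = (\int[lam]_y (f y * (\1_(eball r) (x - y)%R)%:E))%E.
Proof.
move=> mf f0; rewrite ballint_indic -(@ge0_integral_reflection x (fun y =>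
  (f y * (\1_(eball r) (x - y)%R)%:E)%E)).
- by apply: eq_integral => y _; rewrite subKr.
- apply: emeasurable_funM => //.
  exact: (measurableT_comp (measurable_indic_eball r) (measurable_reflection x)).
- by move=> y; rewrite mule_ge0// lee_fin.
Qed.

Lemma eq_ballint f g r x : measurable_fun setT f -> measurable_fun setT g ->
  (forall y, 0 <= f y)%E -> (forall y, 0 <= g y)%E ->
  (\forall y \ae lam, f y = g y) -> ballint f r x = ballint g r x.
Proof.
move=> mf mg f0 g0 fg; rewrite !ballintE//.
have m1 : measurable_fun setT (fun y : 'rV[R]_n => (\1_(eball r) (x - y)%R)%:E : \bar R).
  exact: (measurableT_comp (measurable_indic_eball r) (measurable_reflection x)).
apply: ge0_ae_eq_integral => //.
- exact: emeasurable_funM.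
- exact: emeasurable_funM.
- by move=> y _; rewrite mule_ge0// lee_fin.
- by move=> y _; rewrite mule_ge0// lee_fin.
- by apply: filterS fg => y -> _.
Qed.

Lemma measurable_ballint f r : measurable_fun setT f -> (forall y, 0 <= f y)%E ->
  measurable_fun setT (ballint f r).
Proof.
move=> mf f0; rewrite (funext (ballint_indic f r)).
apply: (measurable_fun_fubini_tonelli_F (fun p : 'rV[R]_n * 'rV[R]_n =>
   (f (p.1 - p.2)%R * (\1_(eball r) p.2)%:E)%E)); last first.
  by move=> p; rewrite mule_ge0// lee_fin.
apply: emeasurable_funM.
  exact: (measurableT_comp mf measurable_subr_prod).
exact: (measurableT_comp (measurable_indic_eball r) measurable_snd).
Qed.

(** Averaging over balls preserves the integral, by Tonelli and translation
    invariance. *)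
Lemma integral_ballint f r : measurable_fun setT f -> (forall y, 0 <= f y)%E ->
  (\int[lam]_x ballint f r x = lam (eball r) * \int[lam]_x f x)%E.
Proof.
move=> mf f0; under eq_integral do rewrite ballint_indic.
have mF : measurable_fun setT (fun p : 'rV[R]_n * 'rV[R]_n =>
   (f (p.1 - p.2)%R * (\1_(eball r) p.2)%:E)%E).
  apply: emeasurable_funM.
    exact: (measurableT_comp mf measurable_subr_prod).
  exact: (measurableT_comp (measurable_indic_eball r) measurable_snd).
rewrite (fubini_tonelli (fun p : 'rV[R]_n * 'rV[R]_n =>
   (f (p.1 - p.2)%R * (\1_(eball r) p.2)%:E)%E))//=; last first.
  by move=> p; rewrite mule_ge0// lee_fin.
transitivity (\int[lam]_y ((\int[lam]_x f x) * (\1_(eball r) y)%:E))%E.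
  apply: eq_integral => y _.
  have mt : measurable_fun setT (fun x : 'rV[R]_n => x - y).
    exact: (measurableT_comp measurable_subr_prod (measurable_pair2 y)).
  rewrite ge0_integralZr//; last exact: (measurableT_comp mf mt).
  by rewrite (ge0_integral_translation (- y)).
rewrite ge0_integralZl//; last 2 first.
- exact: measurable_indic_eball.
- exact: integral_ge0.
rewrite muleC; congr (_ * _)%E.
rewrite (integral_indic lam measurableT (@measurable_eball R n r)) setIT.
reflexivity.
Qed.

End reflection.

(** * The comparison principle *)

Section ae_equality.
Context d (T : measurableType d) (R : realType).
Variable mu : {measure set T -> \bar R}.

Lemma ae_eq_of_eq_integral (u : T -> R) (w : T -> \bar R) :
  measurable_fun setT u -> measurable_fun setT w -> (forall x, 0 <= u x) ->
  (forall x, 0 <= w x)%E -> (\forall x \ae mu, ((u x)%:E <= w x)%E) ->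
  (\int[mu]_x (u x)%:E < +oo)%E ->
  (\int[mu]_x w x = \int[mu]_x (u x)%:E)%E -> \forall x \ae mu, w x = (u x)%:E.
Proof.
move=> mu_ mw u0 w0 uw uoo E.
have mu' : measurable_fun setT (EFin \o u) by exact/measurable_EFinP.
have iu : mu.-integrable setT (EFin \o u).
  apply/integrableP; split => //.
  by under eq_integral do rewrite gee0_abs ?lee_fin//.
have iw : mu.-integrable setT w.
  apply/integrableP; split => //.
  by under eq_integral do rewrite gee0_abs//; rewrite E.
have md : measurable_fun setT (fun x => w x - (u x)%:E)%E.
  exact: emeasurable_funB.
have : (\int[mu]_x `|w x - (u x)%:E| = 0)%E.
  transitivity (\int[mu]_x (w x - (u x)%:E))%E.
    apply: ae_eq_integral => //; first exact: measurableT_comp.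
    by apply: filterS uw => x uwx _; rewrite gee0_abs// sube_ge0.
  rewrite (integralB measurableT iw iu) E subee//.
  by apply: integrable_fin_num.
move=> /(ae_eq_integral_abs _ measurableT md).
apply: filterS => x /(_ I) /=; case: (w x) => [r| |]//= [] /eqP.
by rewrite subr_eq0 => /eqP ->.
Qed.

End ae_equality.

Section superaveraging.
Context {R : realType} {n : nat}.
Local Notation lam := (lebesgue_rV R n).

(** Superharmonicity in the sense of averages, for functions defined almost
    everywhere. *)
Record superaveraging (g : 'rV[R]_n -> R) : Prop := Superaveraging {
  sa_measurable : measurable_fun setT g ;
  sa_ge0 : forall x, 0 <= g x ;
  sa_ballint : forall r, 0 < r -> \forall x \ae lam,
    (ballint (EFin \o g) r x <= lam (eball r) * (g x)%:E)%E }.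

End superaveraging.

Section comparison.
Context {R : realType} {n : nat}.
Local Notation lam := (lebesgue_rV R n.+1).
Implicit Types x y : 'rV[R]_n.+1.
Variables (g : 'rV[R]_n.+1 -> R) (a m r1 r2 K : R).
Hypotheses (sa_g : superaveraging g) (a0 : 0 < a) (an : n.+1%:R < 2 * a + 2).
Hypotheses (r10 : 0 < r1) (r12 : r1 < r2) (m0 : 0 < m) (K0 : 0 < K).
Hypothesis (gm : \forall x \ae lam, enorm x < r2 -> m <= g x).

(* [H] is normalised so that [H <= m] outside the ball of radius [r1]; [K] makes
   it negative far away. The cut-off in [v] removes the singularity of [H]. *)
Let C := m * (r1 ^+ 2) `^ a.
Let H x := C * (sqn x `^ (- a) - K).
Let v x := Num.max (H x - g x) 0 * \1_[set x | r1 < enorm x] x.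

Let C0 : 0 < C.
Proof. by rewrite mulr_gt0// powR_gt0// exprn_gt0. Qed.

Let v_ge0 x : 0 <= v x.
Proof. by rewrite mulr_ge0// le_max lexx orbT. Qed.

Let v_gt0 x : 0 < v x -> r1 < enorm x /\ v x = H x - g x.
Proof.
rewrite /v indicE; case: (boolP (x \in _)) => [|_]; last by rewrite mulr0 ltxx.
rewrite inE/= => r1x; rewrite mulr1 lt_max ltxx orbF => h.
by split => //; apply/max_idPl; exact: ltW.
Qed.

Let v_ge x : r1 < enorm x -> H x - g x <= v x.
Proof.
by move=> r1x; rewrite /v indicE mem_set//= mulr1 le_max lexx.
Qed.

Let sqn_powRN x : r1 < enorm x -> C * sqn x `^ (- a) <= m.
Proof.
move=> r1x; have r120 : 0 < r1 ^+ 2 by rewrite exprn_gt0.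
apply: (@le_trans _ _ (C * (r1 ^+ 2) `^ (- a))).
  rewrite ler_pM2l//; apply: powRN_le => //; first exact: ltW.
  by rewrite -sqr_enorm ler_pXn2r ?nnegrE ?enorm_ge0// ltW.
by rewrite /C powRN mulfK// gt_eqF// powR_gt0.
Qed.

Let H_le x : r1 < enorm x -> H x <= m.
Proof.
move=> /sqn_powRN; rewrite /H mulrBr; apply: le_trans.
by rewrite gerBl mulr_ge0// ltW.
Qed.

Let M := Num.sqrt (K `^ (- a^-1)).

Let M0 : 0 < M. Proof. by rewrite sqrtr_gt0 powR_gt0. Qed.

Let v_support x : 0 < v x -> enorm x < M.
Proof.
move=> /[dup] vx0 /v_gt0[r1x vE]; rewrite enorm_lt; last exact: ltW.
rewrite sqr_sqrtr ?powR_ge0// ltNge; apply/negP => h.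
have := powRN_le (ltW a0) (powR_gt0 _ K0) h.
rewrite -powRrM mulrNN mulVf ?gt_eqF// powRr1 ?(ltW K0)// => h2.
move: vx0; rewrite vE; apply/negP; rewrite -leNgt.
rewrite subr_le0; apply: le_trans (sa_ge0 sa_g x).
by rewrite /H pmulr_rle0// subr_le0.
Qed.

Let v_le x : v x <= m * \1_(eball M) x.
Proof.
have [vx0|] := ltP 0 (v x); last first.
  by move=> vx0; rewrite (le_trans vx0)// mulr_ge0 ?(ltW m0)// indicE ler0n.
rewrite indicE mem_set ?mulr1; last exact: v_support.
have [r1x ->] := v_gt0 vx0.
by rewrite (le_trans _ (H_le r1x))// gerBl (sa_ge0 sa_g).
Qed.

Let mH : measurable_fun setT H.
Proof.
apply: measurable_funM => //; apply: measurable_funB => //.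
exact: (measurableT_comp (measurable_powR (- a)) measurable_sqn).
Qed.

Let mv : measurable_fun setT v.
Proof.
apply: measurable_funM; last first.
  by apply: measurable_indic; exact: measurable_enorm_gt.
apply: measurable_maxr => //; apply: measurable_funB => //.
exact: sa_measurable sa_g.
Qed.

Let v_integral : (\int[lam]_x (v x)%:E < +oo)%E.
Proof.
apply: (@le_lt_trans _ _ (\int[lam]_x (m%:E * (\1_(eball M) x)%:E))%E).
  apply: ge0_le_integral => //.
  - by move=> x _; rewrite lee_fin.
  - exact/measurable_EFinP.
  - by apply: emeasurable_funM; [exact: measurable_cst|exact: measurable_indic_eball].
  - by move=> x _; rewrite -EFinM lee_fin.
rewrite ge0_integralZl//; last 2 first.
- exact: measurable_indic_eball.
- by rewrite lee_fin ltW.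
rewrite (integral_indic lam measurableT (@measurable_eball R n.+1 M)) setIT.
by rewrite [X in (_ * X)%E](@lebesgue_eball R n.+1 M)// -EFinM ltry.
Qed.

(* [v] vanishes in the ball of radius [r2], and around a point outside that ball
   the averages at scale [eps] only see points outside the ball of radius [r1],
   where the cut-off is not felt. *)
Let eps := r2 - r1.
Let eps0 : 0 < eps. Proof. by rewrite subr_gt0. Qed.

Let vol : R := eps ^+ n.+1 * @ballvol R n.+1.
Let vol0 : 0 < vol. Proof. by rewrite mulr_gt0 ?exprn_gt0// ballvol_gt0. Qed.
Let volE : lam (eball eps) = vol%:E. Proof. exact: lebesgue_eball. Qed.

Let v_strict : \forall x \ae lam,
  0 < v x -> ((vol * v x)%:E < ballint (EFin \o v) eps x)%E.
Proof.
apply: filterS2 gm (sa_ballint sa_g eps0) => x gmx avx vx0.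
have [r1x vE] := v_gt0 vx0.
have r2x : r2 <= enorm x.
  rewrite leNgt; apply/negP => /gmx mg; move: vx0; rewrite vE subr_gt0 ltNge.
  by rewrite (le_trans (H_le r1x)).
have eps_x : 0 < eps < enorm x.
  by rewrite eps0 (lt_le_trans _ r2x)// gtrBl.
have := ball_mean_pow_gt a0 an eps_x.
have mB := @measurable_eball R n.+1 eps.
have mr := @measurable_reflection R n.+1 x.
have mp : measurable_fun setT (fun y => sqn (x - y) `^ (- a)).
  exact: (measurableT_comp (measurableT_comp (measurable_powR (- a)) measurable_sqn) mr).
have mvx : measurable_fun setT (fun y => v (x - y)) by exact: (measurableT_comp mv mr).
have mgx : measurable_fun setT (fun y => g (x - y)).
  exact: (measurableT_comp (sa_measurable sa_g) mr).
rewrite volE -EFinM.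
rewrite -(@lte_pmul2l _ C%:E) ?lte_fin//.
rewrite -ge0_integralZl ?lee_fin ?(ltW C0)//; last 2 first.
- by apply/measurable_EFinP; exact: measurable_funTS.
- by move=> y _; rewrite lee_fin powR_ge0.
have CK0 : 0 <= C * K by rewrite mulr_ge0// ltW.
have : (\int[lam]_(y in eball eps) (C%:E * (sqn (x - y) `^ (- a))%:E) <=
    \int[lam]_(y in eball eps) ((v (x - y))%:E + ((g (x - y))%:E + (C * K)%:E)))%E.
  apply: ge0_le_integral => //.
  - by move=> y _; rewrite -EFinM lee_fin mulr_ge0 ?powR_ge0// ltW.
  - by apply: emeasurable_funM => //; apply/measurable_EFinP; exact: measurable_funTS.
  - apply/measurable_EFinP/measurable_funTS; apply: measurable_funD => //.
    exact: measurable_funD.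
  - move=> y yeps; rewrite -EFinM -!EFinD lee_fin.
    have r1xy : r1 < enorm (x - y).
      apply: lt_le_trans (lerB_enorm _ _); move: yeps; rewrite /eball/= /eps; lra.
    have := v_ge r1xy; rewrite /H mulrBr; lra.
rewrite ge0_integralD//; last 4 first.
- by move=> y _; rewrite lee_fin.
- by apply/measurable_EFinP; exact: measurable_funTS.
- by move=> y _; rewrite -EFinD lee_fin addr_ge0// (sa_ge0 sa_g).
- by apply/measurable_EFinP/measurable_funTS; exact: measurable_funD.
rewrite ge0_integralD//; last 2 first.
- by move=> y _; rewrite lee_fin (sa_ge0 sa_g).
- by apply/measurable_EFinP; exact: measurable_funTS.
rewrite integral_cst// [X in ((C * K)%:E * X)%E](_ : _ = vol%:E)// -EFinM.
move=> h1 h2; have := lt_le_trans h2 h1.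
rewrite -/(ballint (EFin \o v) eps x) -/(ballint (EFin \o g) eps x).
move: avx; rewrite volE -EFinM vE.
have : (0 <= ballint (EFin \o g) eps x)%E.
  by apply: integral_ge0 => y _; rewrite lee_fin (sa_ge0 sa_g).
case: (ballint (EFin \o g) eps x) => [s| |]// _.
rewrite lee_fin => sg.
have : (0 <= ballint (EFin \o v) eps x)%E.
  by apply: integral_ge0 => y _; rewrite lee_fin.
case: (ballint (EFin \o v) eps x) => [t _| _ _|]//; last by rewrite ltry.
rewrite -!EFinD -!EFinM !lte_fin /H => h.
have -> : vol * (C * (sqn x `^ (- a) - K) - g x) =
   C * (vol * sqn x `^ (- a)) - vol * g x - C * K * vol by ring.
lra.
Qed.

(** [v] is at most its average, with the same integral, so the two agree almost
    everywhere; this contradicts [v_strict] wherever [v > 0]. *)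
Lemma superaveraging_ge : \forall x \ae lam,
  r1 < enorm x -> m * (r1 ^+ 2) `^ a * (sqn x `^ (- a) - K) <= g x.
Proof.
have mV : measurable_fun setT (EFin \o v) by exact/measurable_EFinP.
have V0 x : (0 <= (EFin \o v) x)%E by rewrite lee_fin.
have : \forall x \ae lam, ballint (EFin \o v) eps x = (vol * v x)%:E.
  apply: ae_eq_of_eq_integral.
  - exact: measurable_funM.
  - exact: measurable_ballint.
  - by move=> x; rewrite mulr_ge0// ltW.
  - by move=> x; apply: integral_ge0 => y _; rewrite lee_fin.
  - apply: filterS v_strict => x h.
    have [/h/ltW//|vx0] := ltP 0 (v x).
    rewrite (_ : v x = 0) ?mulr0; last by apply/eqP; rewrite eq_le vx0 v_ge0.
    by apply: integral_ge0 => y _; rewrite lee_fin.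
  - under eq_integral do rewrite EFinM.
    rewrite ge0_integralZl ?lee_fin ?(ltW vol0)//.
      by rewrite lte_mul_pinfty// lee_fin ltW.
    by move=> y _; rewrite lee_fin.
  - rewrite [LHS](integral_ballint eps mV V0) volE.
    under [RHS]eq_integral do rewrite EFinM.
    by rewrite ge0_integralZl ?lee_fin ?(ltW vol0)// => y _; rewrite lee_fin.
apply: filterS2 v_strict => x h E r1x.
rewrite -subr_le0; apply: le_trans (v_ge r1x) _.
by rewrite leNgt; apply/negP => /h; rewrite E ltxx.
Qed.

End comparison.

(** * Superaveraging functions decay no faster than the Newtonian kernel *)

Section limits.
Context {R : realType}.

Lemma ler_invn_limit (A B G : R) :
  (forall k : nat, A - B / k.+1%:R <= G) -> A <= G.
Proof.
move=> h; rewrite leNgt; apply/negP => GA.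
have AG : 0 < A - G by rewrite subr_gt0.
pose k := Num.bound `|B / (A - G)|.
have : `|B / (A - G)| < k.+1%:R.
  by apply: lt_trans (archi_boundP _) _; rewrite ?ltr_nat.
move=> /(le_lt_trans (ler_norm _)); rewrite ltr_pdivrMr// => Bk.
have := h k; rewrite leNgt => /negP; apply.
by rewrite ltrBrDl -ltrBrDr ltr_pdivrMr// mulrC.
Qed.

(** Continuity of a power in its exponent, in the form [t^e >= 1 + e ln t]. *)
Lemma powR_invn_limit (t b m G : R) : 0 < t -> 0 <= m ->
  (forall k : nat, m * t `^ (b + k.+1%:R^-1) <= G) -> m * t `^ b <= G.
Proof.
move=> t0 m0 h; apply: (@ler_invn_limit _ (- (m * t `^ b * ln t))) => k.
apply: le_trans (h k); rewrite powRD; last by rewrite (gt_eqF t0) implybT.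
rewrite (_ : _ - _ = m * t `^ b * (1 + k.+1%:R^-1 * ln t)); last by ring.
rewrite mulrA ler_wpM2l ?mulr_ge0 ?powR_ge0//.
by rewrite {1}/powR gt_eqF//; exact: expR_ge1Dx.
Qed.

End limits.

Section liouville.
Context {R : realType} {n : nat}.
Local Notation lam := (lebesgue_rV R n.+1).
Implicit Types (x y : 'rV[R]_n.+1) (g : 'rV[R]_n.+1 -> R).

Lemma ae_ex (P : 'rV[R]_n.+1 -> Prop) : (\forall x \ae lam, P x) -> exists x, P x.
Proof.
move=> [N [mN N0 PN]]; apply: contrapT => /forallNP nP.
have : (lam (eball 1) <= lam N)%E.
  apply: le_measure; rewrite ?inE//; first exact: measurable_eball.
  by move=> x _; apply: PN; exact: nP.
rewrite ballvolE [X in (_ <= X)%E](_ : _ = 0%E)// lee_fin.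
by rewrite leNgt ballvol_gt0.
Qed.

(** Half of the infimum of the positive exponents [p] for which [|x|^(-p)] is
    strictly subharmonic away from the origin. *)
Definition decay : R := Num.max ((n.+1%:R - 2) / 2) 0.

(** The limit of [superaveraging_ge] along [K = 1/(l+1)] and
    [a = decay + 1/(k+1)], countably many parameters so that the exceptional null
    sets can be united. *)
Lemma superaveraging_lower_bound g (m r1 r2 : R) : superaveraging g ->
  0 < r1 < r2 -> 0 < m -> (\forall x \ae lam, enorm x < r2 -> m <= g x) ->
  \forall x \ae lam, r1 < enorm x -> m * (r1 ^+ 2 / sqn x) `^ decay <= g x.
Proof.
move=> sg /andP[r10 r12] m0 gm.
have : \forall x \ae lam, forall k l : nat, r1 < enorm x ->
    m * (r1 ^+ 2) `^ (decay + k.+1%:R^-1) *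
    (sqn x `^ (- (decay + k.+1%:R^-1)) - l.+1%:R^-1) <= g x.
  apply/ae_foralln => k; apply/ae_foralln => l.
  have k0 : 0 < k.+1%:R^-1 :> R by rewrite invr_gt0.
  have d0 : 0 <= decay by rewrite le_max lexx orbT.
  have dn : (n.+1%:R - 2) / 2 <= decay by rewrite le_max lexx.
  apply: (@superaveraging_ge _ _ _ _ _ _ r2) => //.
  - by rewrite ltr_wpDl.
  - move: k0 dn; rewrite ler_pdivrMr//.
    by move: (k.+1%:R^-1) (n.+1%:R) => e N e0 dn; lra.
apply: filterS => x h r1x.
have q0 : 0 < sqn x by rewrite -sqr_enorm exprn_gt0// (lt_trans r10).
have r0 : 0 < r1 ^+ 2 by rewrite exprn_gt0.
apply: powR_invn_limit; [by rewrite divr_gt0|exact: ltW|move=> k].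
set b := decay + _.
rewrite powRM ?(ltW r0) ?invr_ge0 ?(ltW q0)// -(powR_inv1 (ltW q0)) -powRrM mulN1r mulrA.
apply: (@ler_invn_limit _ _ (m * (r1 ^+ 2) `^ b)) => l.
by rewrite -mulrBr; exact: h.
Qed.

Lemma integral_eball_gt0 (f : 'rV[R]_n.+1 -> \bar R) : measurable_fun setT f ->
  ~ (\forall x \ae lam, f x = 0%E) ->
  exists k : nat, exists2 m : R, 0 < m &
    (m%:E <= \int[lam]_(x in eball k.+1%:R) `|f x|)%E.
Proof.
move=> mf f_neq0.
have [k Ik] : exists k : nat, (0 < \int[lam]_(x in eball k.+1%:R) `|f x|)%E.
  apply: contrapT => /forallNP noI; apply: f_neq0.
  have : \forall x \ae lam, forall k : nat, eball k.+1%:R x -> f x = 0%E.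
    apply/ae_foralln => k; have mB := @measurable_eball R n.+1 k.+1%:R.
    apply/(ae_eq_integral_abs _ mB (measurable_funTS mf)).
    by apply/eqP; rewrite eq_le integral_ge0//= ?andbT leNgt; apply/negP/noI.
  apply: filterS => x /(_ (Num.bound (enorm x))); apply; rewrite /eball/=.
  by apply: lt_trans (archi_boundP (enorm_ge0 _)) _; rewrite ltr_nat.
exists k; case: (integral _ _ _) Ik => [s| |]//.
  by rewrite lte_fin => s0; exists s.
by move=> _; exists 1 => //; rewrite leey.
Qed.

(** The averages over large balls bound [g] from below near the origin, since the
    balls around these points contain a fixed ball. *)
Lemma superaveraging_gt0 g r : superaveraging g -> 0 < r ->
  ~ (\forall x \ae lam, g x = 0) ->
  exists2 m, 0 < m & \forall x \ae lam, enorm x < r -> m <= g x.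
Proof.
move=> sg r0 g_neq0.
have mg : measurable_fun setT (EFin \o g).
  by apply/measurable_EFinP; exact: sa_measurable sg.
have g0 x : (0 <= (g x)%:E)%E by rewrite lee_fin (sa_ge0 sg).
have [|k [m1 m10 m1I]] := integral_eball_gt0 mg.
  by apply: contra_not g_neq0; apply: filterS => x [].
have {m1I} m1I : (m1%:E <= \int[lam]_(x in eball k.+1%:R) (g x)%:E)%E.
  apply: le_trans m1I _; rewrite (eq_integral (EFin \o g))// => x _.
  by rewrite /= ger0_norm// (sa_ge0 sg).
pose rho := k.+1%:R + r.
have rho0 : 0 < rho by rewrite addr_gt0.
pose vol := rho ^+ n.+1 * @ballvol R n.+1.
have vol0 : 0 < vol by rewrite mulr_gt0 ?exprn_gt0// ballvol_gt0.
exists (m1 / vol); first by rewrite divr_gt0.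
apply: filterS (sa_ballint sg rho0) => x; rewrite lebesgue_eball// -/vol -EFinM.
move=> h xr; rewrite ler_pdivrMr// mulrC -lee_fin; apply: le_trans h.
apply: (le_trans m1I).
rewrite ballintE// integral_mkcond; apply: ge0_le_integral => //.
- by move=> y _; rewrite patchE; case: ifPn.
- apply/(measurable_restrictT _ _).1 => //; first exact: measurable_eball.
  exact: measurable_funTS.
- apply: emeasurable_funM => //.
  exact: (measurableT_comp (measurable_indic_eball rho) (measurable_reflection x)).
- move=> y _; rewrite patchE; case: ifPn => [|_]; last first.
    by apply: mule_ge0; [exact: g0|rewrite lee_fin indicE ler0n].
  rewrite inE /eball/= => yk; rewrite indicE mem_set ?mule1//.
  by rewrite /= (le_lt_trans (ler_enormB _ _))// addrC ltrD.
Qed.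

Lemma superaveragingB g c : superaveraging g ->
  (\forall x \ae lam, c <= g x) -> 0 <= c ->
  superaveraging (fun x => Num.max (g x - c) 0).
Proof.
move=> sg gc c0; split.
- apply: measurable_maxr => //; apply: measurable_funB => //.
  exact: sa_measurable sg.
- by move=> x; rewrite le_max lexx orbT.
move=> r r0; apply: filterS2 (gc) (sa_ballint sg r0) => x cx h.
set G := fun x => _.
have G0 y : 0 <= G y by rewrite le_max lexx orbT.
have mG : measurable_fun setT G.
  apply: measurable_maxr => //; apply: measurable_funB => //.
  exact: sa_measurable sg.
have mBr := @measurable_eball R n.+1 r.
have mr := @measurable_reflection R n.+1 x.
pose vol := r ^+ n.+1 * @ballvol R n.+1.
have volE : lam (eball r) = vol%:E by exact: lebesgue_eball.
have E : (ballint (EFin \o g) r x = ballint (EFin \o G) r x + (c * vol)%:E)%E.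
  transitivity (ballint (fun y => (G y)%:E + c%:E)%E r x).
    apply: eq_ballint.
    - by apply/measurable_EFinP; exact: sa_measurable sg.
    - by apply/measurable_EFinP; exact: measurable_funD.
    - by move=> y; rewrite lee_fin (sa_ge0 sg).
    - by move=> y; rewrite -EFinD lee_fin addr_ge0.
    - apply: filterS gc => y cy; rewrite /= -EFinD /G; congr (_%:E).
      by rewrite (max_idPl _) ?subr_ge0// subrK.
  rewrite /ballint ge0_integralD//; last 2 first.
  - by move=> y _; rewrite lee_fin.
  - apply/measurable_EFinP/measurable_funTS; exact: (measurableT_comp mG mr).
  by rewrite integral_cst// [X in (_ + c%:E * X)%E]volE EFinM.
move: h; rewrite E volE -!EFinM.
have : (0 <= ballint (EFin \o G) r x)%E.
  by apply: integral_ge0 => y _; rewrite lee_fin.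
case: (ballint (EFin \o G) r x) => [t _| |]//.
rewrite -EFinD !lee_fin (max_idPl _) ?subr_ge0// mulrBr lerBrDr.
by rewrite [vol * c]mulrC.
Qed.

(** In dimension at most 2 the bound of [superaveraging_lower_bound] does not
    decay. *)
Lemma superaveraging_global_gt0 g : (n.+1 <= 2)%N -> superaveraging g ->
  ~ (\forall x \ae lam, g x = 0) ->
  exists2 m, 0 < m & \forall x \ae lam, m <= g x.
Proof.
move=> n2 sg g_neq0.
have [m m0 gm] := superaveraging_gt0 sg (@ltr0Sn R 1) g_neq0.
have r12 : 0 < (1 : R) < 2 by rewrite ltr01 ltr1n.
exists m => //; apply: filterS2 (gm) (superaveraging_lower_bound sg r12 m0 gm) => x.
move=> h1 h2; have [/h1//|x2] := ltP (enorm x) 2.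
have : 1 < enorm x by rewrite (lt_le_trans _ x2)// ltr1n.
move=> /h2; rewrite (_ : decay = 0) ?powRr0 ?mulr1//.
by apply/max_idPr; rewrite pmulr_lle0// subr_le0 ler_nat.
Qed.

(** In dimension at most 2, [g] minus its essential infimum is superaveraging; if
    it were not zero, [superaveraging_global_gt0] would bound it below by a
    positive constant, against the definition of the essential infimum. *)
Lemma superaveraging_liouville g : superaveraging g ->
  ~ (exists c, \forall x \ae lam, g x = c) ->
  (3 <= n.+1)%N /\ exists2 c, 0 < c &
    \forall x \ae lam, 1 < enorm x -> c * enorm x `^ (2 - n.+1%:R) <= g x.
Proof.
move=> sg gc.
have g_neq0 : ~ (\forall x \ae lam, g x = 0) by apply: contra_not gc; exists 0.
have [n3|n2] := leqP 3 n.+1.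
  split => //; have [m m0 gm] := superaveraging_gt0 sg (@ltr0Sn R 1) g_neq0.
  have r12 : 0 < (1 : R) < 2 by rewrite ltr01 ltr1n.
  exists m => //; apply: filterS (superaveraging_lower_bound sg r12 m0 gm) => x h x1.
  apply: le_trans (h x1); rewrite expr1n div1r ler_pM2l//.
  have -> : decay = (n.+1%:R - 2) / 2.
    by apply/max_idPl; rewrite divr_ge0// subr_ge0 ler_nat ltnW.
  rewrite -powR_inv1 ?sqn_ge0// -powRrM -sqr_enorm -powR_mulrn ?enorm_ge0//.
  rewrite -powRrM (_ : 2 * (-1 * ((n.+1%:R - 2) / 2)) = 2 - n.+1%:R)//.
  by move: (n.+1%:R) => N; lra.
exfalso; apply: gc.
pose S := [set c : R | 0 <= c /\ \forall x \ae lam, c <= g x].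
have S0 : S 0 by split => //; apply/aeW => x; exact: sa_ge0 sg _.
have supS : has_sup S.
  split; first by exists 0.
  apply: contrapT => nub.
  have kg (k : nat) : \forall x \ae lam, k%:R <= g x.
    have [c [[_ cg] kc]] : exists c, S c /\ k%:R < c.
      apply: contrapT => h; apply: nub; exists k%:R => c Sc.
      by rewrite leNgt; apply/negP => kc; apply: h; exists c.
    by apply: filterS cg => x; apply: le_trans; exact: ltW.
  have /ae_ex[x /(_ (Num.bound (g x)))] : \forall x \ae lam, forall k : nat, k%:R <= g x.
    by apply/ae_foralln.
  by rewrite leNgt archi_boundP// (sa_ge0 sg).
have supg : \forall x \ae lam, sup S <= g x.
  have : \forall x \ae lam, forall k : nat, sup S - 1 / k.+1%:R <= g x.
    apply/ae_foralln => k.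
    have [c [_ cg] kc] := sup_adherent (divr_gt0 ltr01 (ltr0Sn R k)) supS.
    by apply: filterS cg => x; apply: le_trans; exact: ltW.
  by apply: filterS => x; exact: ler_invn_limit.
have supS0 : 0 <= sup S by exact: sup_upper_bound.
have [G0|G_neq0] := pselect (\forall x \ae lam, Num.max (g x - sup S) 0 = 0).
  exists (sup S); apply: filterS2 (supg) G0 => x gx /eqP.
  by rewrite (max_idPl _) ?subr_ge0// subr_eq0 => /eqP.
have [m m0 mG] := superaveraging_global_gt0 n2 (superaveragingB sg supg supS0) G_neq0.
have : S (sup S + m).
  split; first by rewrite addr_ge0// ltW.
  apply: filterS2 (supg) mG => x gx; rewrite (max_idPl _) ?subr_ge0//.
  by rewrite lerBrDl.
by move=> /(sup_upper_bound supS); rewrite gerDl leNgt m0.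
Qed.

End liouville.

(** * An explicit fixed point *)

Section maximal_operator.
Context {R : realType} {n : nat}.
Local Notation lam := (lebesgue_rV R n).
Implicit Types (f : 'rV[R]_n -> \bar R) (x : 'rV[R]_n) (r : R).

Lemma maximal_leP f x (M : \bar R) :
  (forall r, 0 < r -> (ballint (fun y => `|f y|%E) r x <= lam (eball r) * M)%E) <->
  (maximal f x <= M)%E.
Proof.
have volE r : 0 < r -> exists2 v : R, 0 < v & lam (eball r) = v%:E.
  move=> r0; exists (r ^+ n * @ballvol R n); last exact: lebesgue_eball.
  by rewrite mulr_gt0 ?exprn_gt0// ballvol_gt0.
split=> [h|h r r0].
  apply: ge_ereal_sup => _ [r /= r0 <-]; rewrite in_itv/= andbT in r0.
  have := h r r0; have [v v0 ->] := volE _ r0.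
  by rewrite inver gt_eqF// lee_pdivrMl.
have [v v0 vE] := volE _ r0; rewrite vE -lee_pdivrMl//; apply: le_trans h.
apply: ereal_sup_ubound; exists r; first by rewrite /= in_itv/= r0.
by rewrite vE inver gt_eqF.
Qed.

Lemma maximal_ge f x r (c : R) : 0 < r -> 0 <= c -> measurable_fun setT f ->
  (forall y, enorm y < r -> (c%:E <= `|f (x - y)%R|)%E) -> (c%:E <= maximal f x)%E.
Proof.
move=> r0 c0 mf cf.
have := (maximal_leP f x (maximal f x)).2 (lexx _) r r0.
have mB := @measurable_eball R n r.
have : (c%:E * lam (eball r) <= ballint (fun y => `|f y|%E) r x)%E.
  rewrite -(integral_cst lam mB); apply: ge0_le_integral => //.
  apply: measurable_funTS; apply: measurableT_comp => //.
  exact: (measurableT_comp mf (measurable_reflection x)).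
move=> /le_trans h /h; rewrite muleC lebesgue_eball// lee_pmul2l// lte_fin.
by rewrite mulr_gt0 ?exprn_gt0// ballvol_gt0.
Qed.

Lemma ae_ex_in (P : 'rV[R]_n -> Prop) (E : set 'rV[R]_n) : measurable E ->
  (0 < lam E)%E -> (\forall x \ae lam, P x) -> exists2 x, E x & P x.
Proof.
move=> mE E0 [N [mN N0 PN]]; apply: contrapT => nP.
move: E0; rewrite ltNge -N0 le_measure ?inE// => x Ex.
by apply: PN => /= Px; apply: nP; exists x.
Qed.

End maximal_operator.

Section explicit_fixed_point.
Context {R : realType} {n : nat}.
Local Notation lam := (lebesgue_rV R n.+1).
Implicit Types (x y : 'rV[R]_n.+1).
Hypothesis n3 : (3 <= n.+1)%N.

Let a : R := (n.+1%:R - 2) / 2.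

Let a0 : 0 < a.
Proof. by rewrite divr_gt0// subr_gt0 ltr_nat. Qed.

Let an : 2 * a + 2 = n.+1%:R.
Proof. by rewrite /a mulrCA mulfV// mulr1 subrK. Qed.

Lemma measurable_sqn_powRN (beta b : R) :
  measurable_fun setT (fun x : 'rV[R]_n.+1 => (beta + sqn x) `^ (- b)).
Proof.
apply: (measurableT_comp (measurable_powR (- b))).
by apply: measurable_funD => //; exact: measurable_sqn.
Qed.

(** A smooth superharmonic function with the decay of the fundamental
    solution. *)
Definition bump x : R := (1 + sqn x) `^ (- ((n.+1%:R - 2) / 2)).

Lemma measurable_bump : measurable_fun setT bump.
Proof. exact: measurable_sqn_powRN. Qed.

Lemma bump_ge0 x : 0 <= bump x.
Proof. exact: powR_ge0. Qed.

(** Averages do not exceed the value at the centre by superharmonicity, and tend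
    to it as the radius tends to 0 by continuity. *)
Lemma maximal_bump x : maximal (EFin \o bump) x = (bump x)%:E.
Proof.
apply/eqP; rewrite eq_le; apply/andP; split.
  apply/maximal_leP => r r0.
  apply: le_trans (ball_mean_pow_le x a0 an ltr01 r0).
  rewrite /ballint le_eqVlt; apply/orP; left; apply/eqP.
  by apply: eq_integral => y _; rewrite /= ger0_norm ?bump_ge0.
pose psi (r : R) := (1 + (enorm x + r) ^+ 2) `^ (- a).
have psi_le r : 0 < r -> ((psi r)%:E <= maximal (EFin \o bump) x)%E.
  move=> r0; apply: (maximal_ge r0) => //; first exact: powR_ge0.
    by apply/measurable_EFinP; exact: measurable_bump.
  move=> y yr; rewrite /= ger0_norm ?bump_ge0// lee_fin.
  apply: powRN_le; [exact: ltW|by rewrite ltr_wpDr ?sqn_ge0|].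
  rewrite lerD2l -sqr_enorm ler_pXn2r ?nnegrE ?enorm_ge0//; last first.
    by rewrite addr_ge0 ?enorm_ge0// ltW.
  by rewrite (le_trans (ler_enormB _ _))// lerD2l ltW.
have psi0 : psi 0 = bump x by rewrite /psi addr0 sqr_enorm.
rewrite -psi0.
have cpsi : (psi r)%:E @[r --> 0^'+] --> (psi 0)%:E.
  apply: cvg_EFin; first exact: nearW.
  apply: cvg_at_right_filter.
  have q0 : 0 < 1 + (enorm x + 0) ^+ 2 by rewrite ltr_wpDr ?sqr_ge0.
  have dq : is_derive (0 : R) 1 (fun t => 1 + (enorm x + t) ^+ 2)
     (2 * (enorm x + 0)).
    by apply: is_derive_eq; rewrite /GRing.scale/=; ring.
  have dp := @is_derive_powRN _ (fun t => 1 + (enorm x + t) ^+ 2) 0 _ a q0 dq.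
  by apply: differentiable_continuous; apply/derivable1_diffP; exact: ex_derive.
apply: (cvge_to_le cpsi); near=> r; apply: psi_le; near: r.
exact: nbhs_right_gt.
Unshelve. all: by end_near. Qed.

(** The values inside the unit ball exceed those in a unit ball far away, and both
    balls have positive measure. *)
Lemma bump_not_constant : ~ (exists c : \bar R, \forall x \ae lam, (bump x)%:E = c).
Proof.
move=> [c gc].
have B0 : (0 < lam (eball 1))%E.
  by rewrite lebesgue_eball// lte_fin mulr_gt0 ?exprn_gt0// ballvol_gt0.
have [x x1 xc] := ae_ex_in (@measurable_eball R n.+1 1) B0 gc.
pose x0 : 'rV[R]_n.+1 := \row_i 3.
have x0_ge : 3 <= enorm x0.
  by apply: le_trans (coor_le_enorm x0 ord0); rewrite mxE ger0_norm.
have mE : measurable ((fun y => x0 - y) @^-1` @eball R n.+1 1).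
  rewrite -[X in measurable X]setTI; apply: measurable_reflection => //.
  exact: measurable_eball.
have E0 : (0 < lam ((fun y => (x0 - y)%R) @^-1` @eball R n.+1 1))%E.
  by rewrite -lebesgue_rV_reflection//; exact: measurable_eball.
have [y y2 yc] := ae_ex_in mE E0 gc.
move: yc; rewrite -xc => -[] /eqP; apply/negP; rewrite lt_eqF//.
rewrite /bump !powRN ltf_pV2 ?posrE ?powR_gt0 ?ltr_wpDr ?sqn_ge0//.
rewrite gt0_ltr_powR ?nnegrE ?addr_ge0 ?sqn_ge0// ltrD2l -!sqr_enorm.
rewrite ltr_pXn2r ?nnegrE ?enorm_ge0//; move: x1 y2; rewrite /eball/= => x1 y2.
have := lerB_enorm x0 (x0 - y); rewrite subKr; lra.
Qed.

End explicit_fixed_point.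

(** * Fixed points in a Banach function space *)

Section domination.
Local Open Scope ereal_scope.
Context d (T : measurableType d) (R : realType).
Variables (mu : {measure set T -> \bar R}) (rho : (T -> \bar R) -> \bar R).
Hypothesis B : banach_function_norm mu rho.

Lemma nonneg_mfun_abse (f : T -> \bar R) : measurable_fun setT f ->
  nonneg_mfun (fun x => `|f x|).
Proof. by move=> mf; split => // ; exact: measurableT_comp. Qed.

Lemma function_space_dominated (f h : T -> \bar R) (C : R) : (0 <= C)%R ->
  measurable_fun setT f -> function_space rho h ->
  (\forall x \ae mu, `|f x| <= C%:E * `|h x|) -> function_space rho f.
Proof.
move=> C0 mf [mh rh] fh; split => //.
have nh := nonneg_mfun_abse mh; have nf := nonneg_mfun_abse mf.
apply: (@le_lt_trans _ _ (rho (fun x => C%:E * `|h x|))).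
  apply: (bfn_lattice B) => //; split; last by move=> x; rewrite mule_ge0.
  by apply: emeasurable_funM => //; exact: nh.1.
rewrite (bfn_scale B)// lte_mul_pinfty//; exact: (bfn_ge0 B).
Qed.

Lemma function_spaceD_indic (h : T -> \bar R) (E : set T) : measurable E ->
  mu E < +oo -> function_space rho h -> nonneg_mfun h ->
  function_space rho (fun x => h x + (\1_E x)%:E).
Proof.
move=> mE Eoo [mh rh] nh.
have nE : nonneg_mfun (fun x => (\1_E x)%:E : \bar R).
  split; last by move=> x; rewrite lee_fin indicE ler0n.
  by apply/measurable_EFinP; exact: measurable_indic.
split; first by apply: emeasurable_funD => //; exact: nE.1.
rewrite /space_norm (_ : (fun _ => _) = (fun x => h x + (\1_E x)%:E)); last first.
  by apply/funext => x; rewrite gee0_abs// adde_ge0 ?nh.2 ?nE.2.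
apply: le_lt_trans (bfn_triangle B nh nE) _.
rewrite lte_add_pinfty ?(bfn_indic B)//.
by move: rh; rewrite /space_norm (_ : (fun _ => _) = h)//; apply/funext => x;
  rewrite gee0_abs// nh.2.
Qed.

End domination.

Section fixed_points.
Context {R : realType} {n : nat}.
Local Notation lam := (lebesgue_rV R n.+1).
Variable rho : ('rV[R]_n.+1 -> \bar R) -> \bar R.
Hypothesis B : banach_function_norm lam rho.

Definition newton_tail (x : 'rV[R]_n.+1) : \bar R :=
  (enorm x `^ (2 - n.+1%:R) * \1_[set y | 1 < enorm y] x)%:E.

Lemma measurable_newton_tail : measurable_fun setT newton_tail.
Proof.
apply/measurable_EFinP; apply: measurable_funM.
  exact: (measurableT_comp (measurable_powR _) measurable_enorm).
by apply: measurable_indic; exact: measurable_enorm_gt.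
Qed.

Lemma newton_tail_ge0 x : (0 <= newton_tail x)%E.
Proof. by rewrite lee_fin mulr_ge0 ?powR_ge0// indicE ler0n. Qed.

Lemma newton_tail_le (h : 'rV[R]_n.+1 -> \bar R) (c : R) : 0 < c ->
  function_space rho h ->
  (\forall x \ae lam, 1 < enorm x -> ((c * enorm x `^ (2 - n.+1%:R))%:E <= `|h x|)%E) ->
  function_space rho newton_tail.
Proof.
move=> c0 rh ch; have ci0 : 0 <= c^-1 by rewrite invr_ge0 ltW.
apply: (function_space_dominated B ci0 measurable_newton_tail rh).
apply: filterS ch => x h1; rewrite gee0_abs ?newton_tail_ge0//.
rewrite lee_pdivlMl// /newton_tail indicE.
have [x1|_] := boolP (x \in _); last by rewrite mulr0 mule0.
by rewrite mulr1 -EFinM; apply: h1; rewrite inE in x1.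
Qed.

(** Functions in the space are integrable on balls. *)
Lemma function_space_ae_fin (f : 'rV[R]_n.+1 -> \bar R) :
  function_space rho f -> \forall x \ae lam, f x \is a fin_num.
Proof.
move=> [mf rf]; have nf := nonneg_mfun_abse mf.
have : \forall x \ae lam, forall k : nat, eball k.+1%:R x -> f x \is a fin_num.
  apply/ae_foralln => k.
  have mB := @measurable_eball R n.+1 k.+1%:R.
  have Boo : (lam (eball k.+1%:R) < +oo)%E by rewrite lebesgue_eball// ltry.
  have [C C0 /(_ _ nf) h] := bfn_local B mB Boo.
  apply: (@integrable_ae _ _ _ lam _ mB); apply/integrableP; split.
    exact: measurable_funTS.
  apply: le_lt_trans h _; rewrite lte_mul_pinfty//; last by rewrite lee_fin ltW.
apply: filterS => x /(_ (Num.bound (enorm x))); apply; rewrite /eball/=.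
by apply: lt_trans (archi_boundP (enorm_ge0 _)) _; rewrite ltr_nat.
Qed.

Lemma fixed_point_newton_tail (f : 'rV[R]_n.+1 -> \bar R) :
  function_space rho f -> ~ (exists c : \bar R, \forall x \ae lam, f x = c) ->
  (\forall x \ae lam, maximal f x = f x) ->
  (3 <= n.+1)%N /\ function_space rho newton_tail.
Proof.
move=> rf fc fM; have [mf _] := rf.
pose g x := fine `|f x|%E.
have fg : \forall x \ae lam, f x = (g x)%:E.
  apply: filterS2 fM (function_space_ae_fin rf) => x E fx.
  have f0 : (0 <= f x)%E.
    rewrite -E.
    by apply: (@maximal_ge _ _ _ _ 1 0) => // y _; exact: abse_ge0.
  by rewrite /g gee0_abs// fineK.
have g0 x : 0 <= g x by rewrite fine_ge0.
have mg : measurable_fun setT g.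
  by apply: measurableT_comp => //; exact: measurableT_comp.
have sg : superaveraging g.
  split=> // r r0; apply: filterS2 (fM) (fg) => x E Eg; rewrite -Eg -E.
  apply: le_trans ((maximal_leP f x _).2 (lexx _) r r0).
  rewrite le_eqVlt; apply/orP; left; apply/eqP; apply: eq_ballint => //.
  - exact/measurable_EFinP.
  - exact: measurableT_comp.
  - by apply: filterS (fg) => y -> /=; rewrite ger0_norm.
have [|n3 [c c0 cg]] := superaveraging_liouville sg.
  move=> [c gc]; apply: fc; exists c%:E.
  by apply: filterS2 (fg) (gc) => x -> ->.
split => //; apply: (newton_tail_le c0 rf).
apply: filterS2 (fg) (cg) => x -> h /h; by rewrite /= ger0_norm.
Qed.

Lemma bump_function_space : (3 <= n.+1)%N -> function_space rho newton_tail ->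
  function_space rho (EFin \o @bump R n).
Proof.
move=> n3 rt.
have B2oo : (lam (eball 2) < +oo)%E by rewrite lebesgue_eball// ltry.
have nt : nonneg_mfun newton_tail.
  by split; [exact: measurable_newton_tail|exact: newton_tail_ge0].
have rs := function_spaceD_indic B (@measurable_eball R n.+1 2) B2oo rt nt.
apply: (function_space_dominated B (@ler01 R) _ rs).
  by apply/measurable_EFinP; exact: measurable_bump.
apply/aeW => x; rewrite mul1e [leRHS]gee0_abs; last first.
  by rewrite adde_ge0 ?newton_tail_ge0// lee_fin indicE ler0n.
rewrite /= ger0_norm ?bump_ge0// /newton_tail -EFinD lee_fin.
have a0 : 0 <= (n.+1%:R - 2) / 2 :> R by rewrite divr_ge0// subr_ge0 ler_nat ltnW.
have [x1|x1] := leP (enorm x) 1.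
  rewrite [X in _ + X]indicE mem_set; last first.
    by rewrite /eball/= (le_lt_trans x1)// ltr1n.
  apply: (@le_trans _ _ 1).
    apply: le_trans (powRN_le a0 ltr01 _) _; last by rewrite powR1.
    by rewrite lerDl sqn_ge0.
  by rewrite lerDr mulr_ge0 ?powR_ge0// indicE ler0n.
have -> : \1_[set y : 'rV[R]_n.+1 | 1 < enorm y] x = 1 :> R by rewrite indicE mem_set.
rewrite mulr1 ler_wpDr//.
have q0 : 0 < sqn x by rewrite -sqr_enorm exprn_gt0// (lt_trans _ x1).
apply: le_trans (powRN_le a0 q0 _) _; first by rewrite lerDr.
rewrite -sqr_enorm -powR_mulrn ?enorm_ge0// -powRrM.
by rewrite (_ : 2 * - ((n.+1%:R - 2) / 2) = 2 - n.+1%:R)//; move: (n.+1%:R : R) => N; lra.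
Qed.


End fixed_points.

(** * The Riesz potential *)

Section newton_kernel.
Context {R : realType} {n : nat}.
Local Notation lam := (lebesgue_rV R n.+1).
Implicit Types (x y z : 'rV[R]_n.+1).
Hypothesis n3 : (3 <= n.+1)%N.

Let a : R := (n.+1%:R - 2) / 2.

Let a0 : 0 < a.
Proof. by rewrite divr_gt0// subr_gt0 ltr_nat. Qed.

Let an : 2 * a + 2 = n.+1%:R.
Proof. by rewrite /a mulrCA mulfV// mulr1 subrK. Qed.

Definition newton z : R := enorm z `^ (2 - n.+1%:R).

Lemma newton_ge0 z : 0 <= newton z. Proof. exact: powR_ge0. Qed.

Lemma newtonE z : newton z = sqn z `^ (- a).
Proof.
rewrite /newton -sqr_enorm -powR_mulrn ?enorm_ge0// -powRrM; congr (_ `^ _).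
rewrite /a; move: (n.+1%:R : R) => N; lra.
Qed.

Lemma newton0 : newton 0 = 0.
Proof.
rewrite /newton enorm0 powR0// subr_eq0 eqr_nat.
by case: n n3 => [|[|]].
Qed.

Lemma measurable_newton : measurable_fun setT newton.
Proof. exact: (measurableT_comp (measurable_powR _) measurable_enorm). Qed.

Lemma newton_le (r : R) z : 0 < r -> r <= enorm z -> newton z <= r `^ (2 - n.+1%:R).
Proof.
move=> r0 rz; rewrite /newton -opprB; apply: powRN_le => //.
by rewrite subr_ge0 ler_nat ltnW.
Qed.

Lemma newton_ge (r : R) z : 0 < enorm z -> enorm z <= r ->
  r `^ (2 - n.+1%:R) <= newton z.
Proof.
move=> z0 zr; rewrite /newton -opprB; apply: powRN_le => //.
by rewrite subr_ge0 ler_nat ltnW.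
Qed.

(** The limit [beta -> 0] of [ball_mean_pow_le]. At [y = x] the integrand is 0 by
    the convention [newton0], while the approximations tend to infinity, so only
    an inequality survives pointwise there. *)
Lemma ball_mean_newton_le x (r : R) : 0 < r -> x != 0 ->
  (ballint (EFin \o newton) r x <= lam (eball r) * (newton x)%:E)%E.
Proof.
move=> r0 x0; have mB := @measurable_eball R n.+1 r.
pose F (k : nat) y : \bar R := ((k.+1%:R^-1 + sqn (x - y)) `^ (- a))%:E.
have mF k : measurable_fun setT (F k).
  apply/measurable_EFinP.
  exact: (measurableT_comp (measurable_sqn_powRN _ _) (measurable_reflection x)).
have F0 k y : (0 <= F k y)%E by rewrite lee_fin powR_ge0.
have k0 (k : nat) : 0 < k.+1%:R^-1 :> R by rewrite invr_gt0.
have q0 : 0 < sqn x.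
  rewrite -sqr_enorm exprn_gt0// lt0r enorm_ge0 andbT; apply: contra x0 => /eqP.
  by move=> /enorm_eq0 ->.
have ndF y : {homo F^~ y : k l / (k <= l)%N >-> (k <= l)%E}.
  move=> k l kl; rewrite lee_fin; apply: powRN_le; first exact: ltW.
    by rewrite ltr_pwDl// sqn_ge0.
  by rewrite lerD2r lef_pV2 ?posrE// ler_nat.
have h := cvg_monotone_convergence (mu := lam) mB (fun k => measurable_funTS (mF k))
  (fun k y _ => F0 k y) (fun y _ => ndF y).
apply: (@le_trans _ _ (\int[lam]_(y in eball r) limn (F ^~ y))%E); last first.
  apply: (cvge_to_le h); apply: nearW => k.
  apply: le_trans (ball_mean_pow_le x a0 an (k0 k) r0) _.
  rewrite lee_pmul2l//; last 2 first.
  - by rewrite lebesgue_eball.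
  - by rewrite lebesgue_eball// lte_fin mulr_gt0 ?exprn_gt0// ballvol_gt0.
  rewrite lee_fin newtonE; apply: powRN_le => //; first exact: ltW.
  by rewrite lerDr ltW.
have mL : measurable_fun setT (fun y => limn (F ^~ y)).
  apply: (emeasurable_fun_cvg F) => [k|y _]; first exact: mF.
  by apply: ereal_nondecreasing_is_cvgn => k l; exact: ndF.
apply: ge0_le_integral => //.
- by move=> y _; rewrite lee_fin newton_ge0.
- apply/measurable_EFinP/measurable_funTS.
  exact: (measurableT_comp measurable_newton (measurable_reflection x)).
- exact: measurable_funTS.
move=> y _ /=.
have [xy0|xy0] := eqVneq (x - y) 0.
  rewrite xy0 newton0; apply: lime_ge.
    by apply: ereal_nondecreasing_is_cvgn => k l; exact: ndF.
  exact: nearW.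
have p0 : 0 < sqn (x - y).
  rewrite -sqr_enorm exprn_gt0// lt0r enorm_ge0 andbT; apply: contra xy0 => /eqP.
  by move=> /enorm_eq0 ->.
rewrite newtonE le_eqVlt; apply/orP; left; apply/eqP/esym/cvg_lim => //.
apply: cvg_EFin; first exact: nearW.
have dp := is_derive1_powR (- a) p0.
have cp : {for sqn (x - y), continuous (fun t : R => t `^ (- a))}.
  by apply: differentiable_continuous; apply/derivable1_diffP; exact: ex_derive.
apply: (continuous_cvg _ cp).
rewrite -[X in _ --> X]add0r; apply: cvgD; last exact: cvg_cst.
exact: cvg_harmonic.
Qed.

Lemma newton1 : (1 : R) `^ (2 - n.+1%:R) = 1.
Proof. by rewrite powR1. Qed.

Lemma riesz_indic x :
  riesz_potential2 (fun y => `|(\1_(eball 1) y)%:E|%E) x =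
  ballint (EFin \o newton) 1 x.
Proof.
rewrite ballint_indic; apply: eq_integral => y _; congr (_ * _)%E.
by rewrite gee0_abs// lee_fin indicE ler0n.
Qed.

(** The bound by [newton x] is the inequality for averages at [x]. Near the origin
    the unit ball around [x] lies in the ball of radius 3 around a unit vector
    [e], and the inequality for averages at [e] applies: hence [3 ^+ n.+1]. *)
Lemma potential_bounds : exists2 C : R, 0 < C & forall x,
  (ballint (EFin \o newton) 1 x <= C%:E)%E /\
  (x != 0 -> (ballint (EFin \o newton) 1 x <= (C * newton x)%:E)%E).
Proof.
pose w := @ballvol R n.+1; have w0 : 0 < w := ballvol_gt0.
pose C := 3 ^+ n.+1 * w.
have C0 : 0 < C by rewrite mulr_gt0 ?exprn_gt0.
have wC : w <= C by rewrite ler_peMl ?(ltW w0)// exprn_ege1// ler1n.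
have mK : measurable_fun setT (EFin \o newton).
  by apply/measurable_EFinP; exact: measurable_newton.
have K0 y : (0 <= (EFin \o newton) y)%E by rewrite lee_fin newton_ge0.
have bound x : x != 0 -> (ballint (EFin \o newton) 1 x <= (w * newton x)%:E)%E.
  move=> x0; apply: le_trans (ball_mean_newton_le (@ltr01 R) x0) _.
  by rewrite lebesgue_eball// -EFinM expr1n mul1r.
exists C => // x; split; last first.
  move=> /bound /le_trans; apply; rewrite lee_fin ler_wpM2r ?newton_ge0//.
have [x1|x1] := leP 1 (enorm x).
  have x0 : x != 0 by apply: contraTneq x1 => ->; rewrite enorm0 ler10.
  apply: (le_trans (bound _ x0)); rewrite lee_fin (le_trans _ wC)//.
  by rewrite ler_piMr ?(ltW w0)// -newton1 newton_le.
pose e : 'rV[R]_n.+1 := \row_i (i == ord0)%:R.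
have e1 : enorm e = 1.
  rewrite /enorm (bigD1 ord0)//= mxE expr1n big1 ?addr0 ?sqrtr1// => i /negPf i0.
  by rewrite mxE i0 expr0n.
have e0 : e != 0.
  apply/eqP => e0; move: e1; rewrite e0 enorm0 => /eqP.
  by rewrite eq_sym oner_eq0.
have le3 : (ballint (EFin \o newton) 3 e <= C%:E)%E.
  have := ball_mean_newton_le (ltr0Sn R 2) e0.
  by rewrite lebesgue_eball// -EFinM /newton e1 newton1 mulr1.
apply: le_trans le3; rewrite !ballintE//; apply: ge0_le_integral => //.
- by move=> y _; rewrite mule_ge0// lee_fin indicE ler0n.
- apply: emeasurable_funM => //.
  exact: (measurableT_comp (measurable_indic_eball _) (measurable_reflection x)).
- apply: emeasurable_funM => //.
  exact: (measurableT_comp (measurable_indic_eball _) (measurable_reflection e)).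
move=> y _; rewrite lee_wpmul2l// lee_fin !indicE.
have [xy|_] := boolP (x - y \in _); last by rewrite ler0n.
rewrite mem_set//; move: xy; rewrite inE /eball/= => xy.
rewrite (_ : e - y = e - (x - (x - y))); last by rewrite subKr.
apply: le_lt_trans (ler_enormB _ _) _; rewrite e1.
have := ler_enormB x (x - y); lra.
Qed.

(** The ball of volume [t] contains the set where the potential exceeds the value
    of [C * newton] on its boundary. *)
Lemma rearrangement_potential (C t : R) : 0 < C -> 0 < t ->
  (forall x, x != 0 -> (ballint (EFin \o newton) 1 x <= (C * newton x)%:E)%E) ->
  (rearrangement lam (ballint (EFin \o newton) 1) t <=
   (C * (t / @ballvol R n.+1) `^ ((2 - n.+1%:R) / n.+1%:R))%:E)%E.
Proof.
move=> C0 t0 PC; pose w := @ballvol R n.+1; have w0 : 0 < w := ballvol_gt0.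
pose r := (t / w) `^ (n.+1%:R^-1).
have r0 : 0 < r by rewrite powR_gt0// divr_gt0.
have rn : r ^+ n.+1 * w = t.
  rewrite -powR_mulrn ?ltW// -powRrM mulVf// powRr1 ?divfK ?gt_eqF//.
  by rewrite divr_ge0// ltW.
have -> : (t / @ballvol R n.+1) `^ ((2 - n.+1%:R) / n.+1%:R) = r `^ (2 - n.+1%:R).
  by rewrite /r -powRrM; congr (_ `^ _); exact: mulrC.
apply: ereal_inf_lbound; exists (C * r `^ (2 - n.+1%:R)) => //; split.
  by rewrite mulr_ge0 ?powR_ge0// ltW.
rewrite -rn -(lebesgue_eball r0); apply: le_measure; rewrite ?inE.
- have mP : measurable_fun setT (ballint (EFin \o newton) 1).
    apply: measurable_ballint; last by move=> y; rewrite lee_fin newton_ge0.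
    by apply/measurable_EFinP; exact: measurable_newton.
  rewrite -[X in measurable X]setTI.
  by apply: emeasurable_fun_o_infty => //; exact: measurableT_comp.
- exact: measurable_eball.
move=> x /=; rewrite /eball/= gee0_abs; last first.
  by apply: integral_ge0 => y _; rewrite lee_fin newton_ge0.
rewrite ltNge => h; rewrite ltNge; apply: contra h => rx.
have x0 : x != 0.
  by apply: contraTneq rx => ->; rewrite enorm0 -ltNge.
apply: (le_trans (PC _ x0)); rewrite lee_fin ler_pM2l//; exact: newton_le.
Qed.

Lemma weakL_potential : (weakL lam (n.+1%:R / (n.+1%:R - 2)) `&` Linfty lam)
  (ballint (EFin \o newton) 1).
Proof.
have mP : measurable_fun setT (ballint (EFin \o newton) 1).
  apply: measurable_ballint; last by move=> y; rewrite lee_fin newton_ge0.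
  by apply/measurable_EFinP; exact: measurable_newton.
have [C C0 PC] := potential_bounds.
have P0 x : (0 <= ballint (EFin \o newton) 1 x)%E.
  by apply: integral_ge0 => y _; rewrite lee_fin newton_ge0.
split; split => //; last first.
  rewrite unlock; case: ifP => _; last exact: ltry.
  apply: (@le_lt_trans _ _ C%:E); last exact: ltry.
  apply/ess_supP; apply/aeW => x /=; rewrite gee0_abs//.
  by have [] := PC x.
pose w := @ballvol R n.+1; have w0 : 0 < w := ballvol_gt0.
pose b : R := (n.+1%:R - 2) / n.+1%:R.
apply: (@le_lt_trans _ _ (C * w `^ b)%:E); last exact: ltry.
apply: ge_ereal_sup => _ [t /= t0 <-]; rewrite in_itv/= andbT in t0.
rewrite invf_div -/b.
apply: (@le_trans _ _ ((t `^ b)%:E * (C * (t / w) `^ (- b))%:E)%E).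
  rewrite lee_wpmul2l ?lee_fin ?powR_ge0//.
  rewrite (_ : - b = (2 - n.+1%:R) / n.+1%:R); last by rewrite /b -mulNr opprB.
  by apply: rearrangement_potential => // x; have [] := PC x.
rewrite -EFinM lee_fin powRM ?(ltW t0) ?invr_ge0 ?(ltW w0)//.
rewrite -(powR_inv1 (ltW w0)) -powRrM mulN1r opprK powRN.
have tb : t `^ b != 0 by rewrite gt_eqF// powR_gt0.
by rewrite le_eqVlt; apply/orP; left; apply/eqP; field.
Qed.

Section riesz_space.
Variable rho : ('rV[R]_n.+1 -> \bar R) -> \bar R.
Hypothesis B : banach_function_norm lam rho.

(** The potential of the indicator of the unit ball is the integral of the kernel
    over a unit ball, which lies in the weak Lebesgue space and is bounded. *)
Lemma weakL_riesz_domain2 :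
  weakL lam (n.+1%:R / (n.+1%:R - 2)) `&` Linfty lam `<=` function_space rho ->
  exists2 f : 'rV[R]_n.+1 -> \bar R, riesz_domain2 rho f &
    ~ \forall x \ae lam, f x = 0%E.
Proof.
move=> /(_ _ weakL_potential) [_ rP].
exists (fun y => (\1_(eball 1) y)%:E).
  split; first by split; [exact: measurable_indic_eball|exact: aeW].
  by rewrite (funext riesz_indic).
move=> f0.
have B0 : (0 < lam (eball 1))%E.
  by rewrite lebesgue_eball// lte_fin mulr_gt0 ?exprn_gt0// ballvol_gt0.
have [x x1 /eqP] := ae_ex_in (@measurable_eball R n.+1 1) B0 f0.
by rewrite indicE mem_set// eqe oner_eq0.
Qed.

Lemma measurable_riesz f : measurable_fun setT f -> (forall y, 0 <= f y)%E ->
  measurable_fun setT (riesz_potential2 f : 'rV[R]_n.+1 -> \bar R).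
Proof.
move=> mf f0.
apply: (measurable_fun_fubini_tonelli_F (fun p : 'rV[R]_n.+1 * 'rV[R]_n.+1 =>
   ((newton (p.1 - p.2))%:E * f p.2)%E)); last first.
  by move=> p; rewrite mule_ge0// lee_fin newton_ge0.
apply: emeasurable_funM.
  apply/measurable_EFinP.
  exact: (measurableT_comp measurable_newton measurable_subr_prod).
exact: (measurableT_comp mf measurable_snd).
Qed.

(** If [f] has mass in the ball of radius [K], then at a point with [|x| > 1] the
    distances to that ball are at most [(1 + K)|x|]. *)
Lemma riesz_domain2_newton_tail (f : 'rV[R]_n.+1 -> \bar R) :
  riesz_domain2 rho f -> ~ (\forall x \ae lam, f x = 0%E) ->
  function_space rho (@newton_tail R n).
Proof.
move=> [[mf _] rf] f_neq0.
have mg : measurable_fun setT (fun x => `|f x|%E) by exact: measurableT_comp.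
have g0 x : (0 <= `|f x|)%E by exact: abse_ge0.
have [k [m m0 mI]] := integral_eball_gt0 mf f_neq0.
pose K : R := k.+1%:R.
have K0 : 0 < K by [].
have mr := measurable_riesz mg g0.
pose c := m * (1 + K) `^ (2 - n.+1%:R).
have c0 : 0 < c by rewrite mulr_gt0// powR_gt0// addr_gt0.
have rI : function_space rho (riesz_potential2 (fun x => `|f x|%E)) by split.
apply: (newton_tail_le B c0 rI); apply/aeW => x x1.
have x0 : 0 < enorm x by rewrite (lt_trans _ x1).
have mB := @measurable_eball R n.+1 K.
rewrite gee0_abs; last first.
  by apply: integral_ge0 => y _; rewrite mule_ge0// lee_fin powR_ge0.
pose D : R := (1 + K) `^ (2 - n.+1%:R) * enorm x `^ (2 - n.+1%:R).
have D0 : 0 <= D by rewrite mulr_ge0 ?powR_ge0.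
rewrite (_ : _ * _ = m * D); last by rewrite /c /D mulrA.
apply: (@le_trans _ _ (D%:E * \int[lam]_(y in eball K) `|f y|)%E).
  by rewrite EFinM muleC lee_wpmul2l.
rewrite -ge0_integralZl//; last exact: measurable_funTS.
rewrite integral_mkcond; apply: ae_ge0_le_integral => //.
- by move=> y _; rewrite patchE; case: ifPn => // _; rewrite mule_ge0.
- apply/(measurable_restrictT _ _).1 => //.
  by apply: emeasurable_funM => //; exact: measurable_funTS.
- by move=> y _; rewrite mule_ge0// lee_fin powR_ge0.
- apply: emeasurable_funM => //; apply/measurable_EFinP.
  exact: (measurableT_comp measurable_newton (measurable_reflection x)).
have xE : [set x] = box (fun i => x ord0 i) (fun i => x ord0 i).
  apply/seteqP; split => y /=; first by move=> -> i; rewrite lexx.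
  by move=> h; apply/rowP => i; apply/eqP; rewrite eq_le andbC; exact: h.
exists [set x]; split; first by rewrite xE; exact: measurable_box.
  by rewrite xE [LHS](lebesgue_rV_box _)// big_ord_recl subrr mul0r.
move=> y /= h; apply: contrapT => /eqP yx; apply: h => _.
rewrite patchE; case: ifPn => [|_]; last by rewrite mule_ge0// lee_fin powR_ge0.
rewrite inE /eball/= => yK; rewrite lee_wpmul2r// lee_fin.
have xy0 : 0 < enorm (x - y).
  rewrite lt0r enorm_ge0 andbT; apply: contra yx => /eqP /enorm_eq0 /eqP.
  by rewrite subr_eq0 eq_sym.
rewrite /D -powRM ?addr_ge0 ?enorm_ge0// ?(ltW K0)//.
apply: newton_ge => //.
apply: le_trans (ler_enormB _ _) _; rewrite mulrDl mul1r lerD2l.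
by rewrite (le_trans (ltW yK))// ler_peMr// ltW.
Qed.

End riesz_space.

End newton_kernel.

(** * Rearrangements *)

Section half_line_ae.
Context {R : realType}.

Lemma ae_half_line (P : measurableTypeR R -> Prop) :
  (forall t : R, 0 < t -> P t) -> \forall t \ae @half_line R, P t.
Proof.
move=> h; exists [set t : R | t <= 0]; split.
- rewrite (_ : [set t : R | t <= 0] = `]-oo, 0]%classic); first exact: measurable_itv.
  by apply/seteqP; split => t /=; rewrite in_itv.
- rewrite /half_line /mrestr (_ : _ `&` _ = set0) ?measure0//.
  by apply/seteqP; split => // t /= []; rewrite in_itv/= andbT leNgt => /negP.
- by move=> t /= nP; rewrite leNgt; apply/negP => /h.
Qed.

End half_line_ae.

Section measurable_rearrangement.
Context d (T : measurableType d) {R : realType}.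
Variable mu : {measure set T -> \bar R}.

Lemma rearrangement_ge0 (f : T -> \bar R) t : (0 <= rearrangement mu f t)%E.
Proof. by apply: le_ereal_inf_tmp => _ [s [s0 _] <-]; rewrite lee_fin. Qed.

Lemma rearrangement_le (f : T -> \bar R) (s t : R) : 0 <= s ->
  (distribution_fun mu f s <= t%:E)%E -> (rearrangement mu f t <= s%:E)%E.
Proof. by move=> s0 st; apply: ereal_inf_lbound; exists s. Qed.

Lemma nonneg_mfun_rearrangement (f : T -> \bar R) : measurable_fun setT f ->
  nonneg_mfun (rearrangement mu f : measurableTypeR R -> \bar R).
Proof.
move=> mf; split; last by move=> t; exact: rearrangement_ge0.
apply: (measurability _ (ErealGenOInfty.measurableE R)) => _ [_ [r ->] <-].
rewrite setTI; have [r0|r0] := ltP r 0.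
  rewrite (_ : _ @^-1` _ = setT); first exact: measurableT.
  apply/seteqP; split => // t _ /=; rewrite in_itv/= andbT.
  by apply: lt_le_trans (rearrangement_ge0 f t); rewrite lte_fin.
rewrite (_ : _ @^-1` _ = [set t : R | (t%:E < distribution_fun mu f r)%E]); last first.
  by apply/seteqP; split => t /=; rewrite in_itv/= andbT rearrangement_gt.
case: (distribution_fun mu f r) => [s| |].
- rewrite (_ : [set _ | _] = `]-oo, s[%classic); first exact: measurable_itv.
  by apply/seteqP; split => t /=; rewrite in_itv.
- rewrite (_ : [set _ | _] = setT); first exact: measurableT.
  by apply/seteqP; split => t //= _; rewrite ltry.
- rewrite (_ : [set _ | _] = set0); first exact: measurable0.
  by apply/seteqP; split.
Qed.

End measurable_rearrangement.

Section representation_space.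
Context {R : realType} {n : nat}.
Local Notation lam := (lebesgue_rV R n.+1).
Hypothesis n3 : (3 <= n.+1)%N.
Variables (rho : ('rV[R]_n.+1 -> \bar R) -> \bar R)
  (rho_bar : (measurableTypeR R -> \bar R) -> \bar R).
Hypothesis rho_rep : representation lam rho rho_bar.

Let a : R := (n.+1%:R - 2) / 2.

Let a0 : 0 < a.
Proof. by rewrite divr_gt0// subr_gt0 ltr_nat. Qed.

Definition newton_profile (t : measurableTypeR R) : \bar R :=
  (\1_`[0, 1] t + t `^ (2 / n.+1%:R - 1) * \1_`[1, +oo[ t)%:E.

Lemma measurable_newton_profile : measurable_fun setT newton_profile.
Proof.
apply/measurable_EFinP; apply: measurable_funD.
  by apply: measurable_indic; exact: measurable_itv.
apply: measurable_funM; first exact: measurable_powR.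
by apply: measurable_indic; exact: measurable_itv.
Qed.

Lemma newton_profile_ge0 t : (0 <= newton_profile t)%E.
Proof. by rewrite lee_fin addr_ge0 ?mulr_ge0 ?powR_ge0// indicE ler0n. Qed.

Lemma newton_profile_lt1 t : 0 < t < 1 -> newton_profile t = 1%E.
Proof.
move=> /andP[t0 t1]; rewrite /newton_profile !indicE mem_set ?memNset.
- by rewrite mulr0 addr0.
- by rewrite /= in_itv/= andbT leNgt t1.
- by rewrite /= in_itv/= !ltW.
Qed.

Lemma newton_profile_ge1 (t : R) : 1 <= t ->
  ((t `^ (2 / n.+1%:R - 1))%:E <= newton_profile t <= (2 * t `^ (2 / n.+1%:R - 1))%:E)%E.
Proof.
move=> t1; rewrite /newton_profile; have -> : \1_`[1%R, +oo[ t = 1 :> R.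
  by rewrite indicE mem_set//= in_itv/= t1.
rewrite mulr1 !lee_fin; set p := t `^ _; apply/andP; split.
  by rewrite lerDr indicE ler0n.
rewrite (_ : 2 * p = p + p); last by ring.
rewrite lerD2r indicE; have [|_] := boolP (t \in _); last exact: powR_ge0.
rewrite inE/= in_itv/= => /andP[_ t_le1].
have t_eq1 : t = 1 by apply/eqP; rewrite eq_le t_le1.
by rewrite /p t_eq1 powR1.
Qed.

(** With [r] the radius of the ball of volume [t], the ball of radius [2r] has
    volume larger than [t], so the rearrangement at [t] is at least the infimum of
    [bump] on it. Doubling the radius costs a constant factor and makes the
    inequality between the volumes strict. *)
Lemma rearrangement_bump_ge (t : R) : 0 < t ->
  (((1 + 4 * (t / @ballvol R n.+1) `^ (2 / n.+1%:R)) `^ (- a))%:E <=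
   rearrangement lam (EFin \o @bump R n) t)%E.
Proof.
move=> t0; pose w := @ballvol R n.+1; have w0 : 0 < w := ballvol_gt0.
pose r := (t / w) `^ (n.+1%:R^-1).
have r0 : 0 < r by rewrite powR_gt0// divr_gt0.
have rn : r ^+ n.+1 * w = t.
  rewrite -powR_mulrn ?ltW// -powRrM mulVf// powRr1 ?divfK ?gt_eqF//.
  by rewrite divr_ge0// ltW.
have -> : (t / @ballvol R n.+1) `^ (2 / n.+1%:R) = r ^+ 2.
  by rewrite -powR_mulrn ?ltW// /r -powRrM; congr (_ `^ _); exact: mulrC.
apply: le_ereal_inf_tmp => _ [s [s0 st] <-]; rewrite lee_fin leNgt; apply/negP => sr.
have r20 : 0 < 2 * r by rewrite mulr_gt0.
have : (lam (eball (2 * r)) <= t%:E)%E.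
  apply: le_trans st; apply: le_measure; rewrite ?inE.
  - exact: measurable_eball.
  - rewrite -[X in measurable X]setTI.
    apply: emeasurable_fun_o_infty => //; apply: measurableT_comp => //.
    by apply/measurable_EFinP; exact: measurable_bump.
  move=> x; rewrite /eball/= => xr; rewrite lte_fin ger0_norm ?bump_ge0//.
  apply: (lt_le_trans sr); apply: powRN_le; first exact: ltW.
    by rewrite ltr_wpDr ?sqn_ge0.
  rewrite lerD2l -sqr_enorm (_ : 4 * r ^+ 2 = (2 * r) ^+ 2); last by ring.
  by rewrite ler_pXn2r ?nnegrE ?enorm_ge0 ?(ltW r20)// ltW.
rewrite lebesgue_eball// lee_fin -rn exprMn -mulrA leNgt ltr_pMl ?rn//.
by rewrite exprn_egt1// ltr1n.
Qed.

(** The rearrangement of [bump] dominates a multiple of the profile, by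
    [rearrangement_bump_ge]. *)
Lemma bump_newton_profile : function_space rho (EFin \o @bump R n) ->
  function_space rho_bar newton_profile.
Proof.
move=> [mb rb]; have [[Bbar _] rep] := rho_rep.
have bE : (fun x => `|(EFin \o @bump R n) x|%E) = EFin \o @bump R n.
  by apply/funext => x; rewrite gee0_abs// lee_fin bump_ge0.
have nb : nonneg_mfun (EFin \o @bump R n).
  by split => // x; rewrite lee_fin bump_ge0.
pose h : measurableTypeR R -> \bar R := rearrangement lam (EFin \o @bump R n).
have [mh h0] := nonneg_mfun_rearrangement lam mb.
have rh : function_space rho_bar h.
  split => //; rewrite /space_norm (_ : (fun x => `|h x|%E) = h).
    by move: rb; rewrite /space_norm bE rep.
  by apply/funext => t; rewrite gee0_abs.
pose w := @ballvol R n.+1; have w0 : 0 < w := ballvol_gt0.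
pose k := (1 + 4 * w^-1 `^ (2 / n.+1%:R)) `^ (- a).
have k1 : 0 < 1 + 4 * w^-1 `^ (2 / n.+1%:R) :> R.
  by rewrite ltr_wpDr// mulr_ge0 ?powR_ge0.
have k0 : 0 < k by rewrite powR_gt0.
have c0 : 0 <= 2 / k by rewrite divr_ge0// ltW.
apply: (function_space_dominated Bbar c0 measurable_newton_profile rh).
apply: ae_half_line => t t0.
rewrite (gee0_abs (newton_profile_ge0 t)) gee0_abs//.
apply: (@le_trans _ _ ((2 / k)%:E *
   ((1 + 4 * (t / w) `^ (2 / n.+1%:R)) `^ (- a))%:E)%E); last first.
  by rewrite lee_wpmul2l//; exact: rearrangement_bump_ge.
rewrite powRM ?(ltW t0) ?invr_ge0 ?(ltW w0)//.
have [t1|t1] := ltP t 1.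
  rewrite newton_profile_lt1 ?t0// -EFinM lee_fin -mulrA.
  apply: (@le_trans _ _ (2 * (k^-1 * k))); first by rewrite mulVf ?gt_eqF// mulr1 ler1n.
  rewrite ler_pM2l// ler_pM2l ?invr_gt0//; apply: powRN_le; first exact: ltW.
    by rewrite ltr_wpDr// !mulr_ge0 ?powR_ge0.
  rewrite lerD2l ler_pM2l// ler_piMl ?powR_ge0//.
  have e0 : 0 <= 2 / n.+1%:R :> R by rewrite divr_ge0.
  have tn : t \is Num.nneg by rewrite nnegrE ltW.
  have := ge0_ler_powR e0 tn (y := 1); rewrite powR1; apply; last exact: ltW.
  by rewrite nnegrE.
have /andP[_ h2] := newton_profile_ge1 t1; apply: (le_trans h2).
rewrite -EFinM lee_fin -mulrA ler_pM2l// ler_pdivlMl//.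
have t20 : 0 <= t `^ (2 / n.+1%:R) := powR_ge0 _ _.
have -> : t `^ (2 / n.+1%:R - 1) = (t `^ (2 / n.+1%:R)) `^ (- a).
  rewrite -powRrM; congr (_ `^ _); rewrite /a.
  by have N0 : (n.+1%:R : R) != 0 by []; field.
rewrite /k -(powRM (- a) (ltW k1) t20).
have p0 : 0 < 1 + 4 * (t `^ (2 / n.+1%:R) * w^-1 `^ (2 / n.+1%:R)).
  by rewrite ltr_wpDr// mulr_ge0// mulr_ge0// powR_ge0.
apply: (powRN_le (ltW a0) p0).
have e0 : 0 <= 2 / n.+1%:R :> R by rewrite divr_ge0.
have T1 : 1 <= t `^ (2 / n.+1%:R) by have := ler_powR t1 e0; rewrite powRr0.
rewrite (_ : (_ + _) * _ = t `^ (2 / n.+1%:R) +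
  4 * (t `^ (2 / n.+1%:R) * w^-1 `^ (2 / n.+1%:R))); last by ring.
by rewrite lerD2r.
Qed.

(** The essential bound controls the rearrangement for [0 < t < 1], the weak bound
    for [t >= 1]. *)
Lemma newton_profile_weakL : function_space rho_bar newton_profile ->
  weakL lam (n.+1%:R / (n.+1%:R - 2)) `&` Linfty lam `<=` function_space rho.
Proof.
move=> rphi f [[mf wf] [_ bf]]; have [[Bbar _] rep] := rho_rep; split => //.
have nf := nonneg_mfun_abse mf.
rewrite /space_norm (rep _ nf).
have -> : rearrangement lam (fun x => `|f x|%E) = rearrangement lam f.
  apply/funext => t; have E s : distribution_fun lam (fun x => `|f x|%E) s =
      distribution_fun lam f s.
    by rewrite /distribution_fun; congr (lam _); apply/seteqP; split => x /=;
      rewrite abse_id.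
  by congr (ereal_inf _); apply/seteqP; split => _ [s [s0 st] <-]; exists s => //;
    split => //; move: st; rewrite E.
have [mh h0] := nonneg_mfun_rearrangement lam mf.
set h : measurableTypeR R -> \bar R := rearrangement lam f in mh h0 *.
have lamT : (0 < lam setT)%E.
  apply: (@lt_le_trans _ _ (lam (eball 1))).
    by rewrite lebesgue_eball// lte_fin mulr_gt0 ?exprn_gt0// ballvol_gt0.
  by apply: le_measure; rewrite ?inE//; exact: measurable_eball.
have [M0 M00 hM0] : exists2 M : R, 0 <= M & forall t : R, 0 <= t -> (h t <= M%:E)%E.
  move: bf; rewrite unlock lamT => bf.
  have [M M0 fM] : exists2 M : R, 0 <= M & \forall x \ae lam, (`|f x| <= M%:E)%E.
    have fe := @ess_sup_ge _ _ _ lam (abse \o f).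
    case: (ess_sup lam (abse \o f)) bf fe => [s _ fs| // |_ fs].
      exists (Num.max s 0); first by rewrite le_max lexx orbT.
      apply: filterS fs => x /= fxs; apply: (le_trans fxs).
      by rewrite lee_fin le_max lexx.
    exists 0 => //; apply: filterS fs => x /= fxs; apply: (le_trans fxs).
    by rewrite leNye.
  exists M => // t t0; apply: rearrangement_le => //.
  suff -> : distribution_fun lam f M = 0%E by rewrite lee_fin.
  apply: (measure_negligible (mu := lam)).
    rewrite -[X in measurable X]setTI.
    by apply: emeasurable_fun_o_infty => //; exact: measurableT_comp.
  have [N [mN N0 fN]] := fM; exists N; split => //.
  by move=> x /= fx; apply: fN => /=; rewrite leNgt fx.
have [M1 M10 hM1] : exists2 M : R, 0 <= M & forall t : R, 0 < t ->
    (h t <= (M * t `^ (2 / n.+1%:R - 1))%:E)%E.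
  move: wf; set S := ereal_sup _ => S_oo.
  have hS (t : R) : 0 < t ->
      ((t `^ ((n.+1%:R / (n.+1%:R - 2))^-1))%:E * h t <= S)%E.
    by move=> t0; apply: ereal_sup_ubound; exists t => //=; rewrite in_itv/= t0.
  have S0 : (0 <= S)%E.
    by apply: le_trans (hS 1 ltr01); rewrite mule_ge0// lee_fin powR_ge0.
  exists (fine S); first exact: fine_ge0.
  move=> t t0; have := hS t t0.
  have -> : (n.+1%:R / (n.+1%:R - 2))^-1 = - (2 / n.+1%:R - 1) :> R.
    by rewrite invf_div mulrBl mulfV// opprB.
  rewrite powRN lee_pdivrMl ?powR_gt0// EFinM muleC fineK// ge0_fin_numE//.
have rh : function_space rho_bar h.
  have M01 : 0 <= M0 + M1 by rewrite addr_ge0.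
  apply: (function_space_dominated Bbar M01 mh rphi).
  apply: ae_half_line => t t0.
  rewrite (gee0_abs (newton_profile_ge0 t)) gee0_abs//.
  have [t1|t1] := ltP t 1.
    rewrite newton_profile_lt1 ?t0// mule1 (le_trans (hM0 _ (ltW t0)))//.
    by rewrite lee_fin lerDl.
  apply: (le_trans (hM1 t t0)); have /andP[h1 _] := newton_profile_ge1 t1.
  apply: (@le_trans _ _ ((M0 + M1)%:E * (t `^ (2 / n.+1%:R - 1))%:E)%E).
    by rewrite -EFinM lee_fin ler_wpM2r ?powR_ge0// lerDr.
  by rewrite lee_wpmul2l// lee_fin.
have [_] := rh; rewrite /space_norm (_ : (fun t => `|h t|%E) = h)//.
by apply/funext => t; rewrite gee0_abs.
Qed.

End representation_space.

(** * The equivalence *)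

Theorem theorem3p5 (R : realType) (n : nat) (n_gt0 : (0 < n)%N)
    (rho : ('rV[R]_n -> \bar R) -> \bar R)
    (rho_bar : (measurableTypeR R -> \bar R) -> \bar R)
    (rho_ri : ri_norm (lebesgue_rV R n) rho)
    (rho_rep : representation (lebesgue_rV R n) rho rho_bar) :
  [<->
       exists f : 'rV[R]_n -> \bar R,
         [/\ function_space rho f,
             ~ (exists c : \bar R, \forall x \ae lebesgue_rV R n, f x = c) &
             \forall x \ae lebesgue_rV R n, maximal f x = f x];
       (3 <= n)%N /\
       function_space rho (fun x : 'rV[R]_n =>
         (enorm x `^ (2 - n%:R) * \1_[set y | 1 < enorm y] x)%:E);
       (3 <= n)%N /\
       function_space rho_bar (fun t : measurableTypeR R =>
         (\1_`[0, 1] t + t `^ (2 / n%:R - 1) * \1_`[1, +oo[ t)%:E);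
       (3 <= n)%N /\
       weakL (lebesgue_rV R n) (n%:R / (n%:R - 2)) `&` Linfty (lebesgue_rV R n)
         `<=` function_space rho;
       (3 <= n)%N /\
       exists2 f : 'rV[R]_n -> \bar R, riesz_domain2 rho f &
         ~ \forall x \ae lebesgue_rV R n, f x = 0%E].
Proof.
move: rho rho_bar rho_ri rho_rep; case: n n_gt0 => // {}n _ rho rho_bar rho_ri rho_rep.
have B := ri_banach rho_ri; tfae.
- move=> [f [rf fc fM]]; exact: (fixed_point_newton_tail B rf fc fM).
- move=> [n3 rt]; split => //.
  exact: (bump_newton_profile n3 rho_rep (bump_function_space B n3 rt)).
- move=> [n3 rphi]; split => //; exact (newton_profile_weakL rho_rep rphi).
- move=> [n3 sub]; split => //; exact: (weakL_riesz_domain2 n3 sub).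
- move=> [n3 [f rf f0]].
  have rt := riesz_domain2_newton_tail n3 B rf f0.
  exists (EFin \o @bump R n); split.
  + exact: bump_function_space B n3 rt.
  + exact: bump_not_constant n3.
  + by apply/aeW => x; exact: maximal_bump n3 x.
Qed.
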